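(* Let the setting, the feature space, the reference coefficients $z_n^\dagger$, the forecast matrices $F_n$, the trajectory $\bar z_n$, the sensors, the data and the Kalman filter be as described in the context. In particular, the frozen feature draw satisfies the approximation event with constant $\varepsilon_{M,\tau}(u^\star)$ and the leverage event $L_\tau\le L_\star$, and the dynamics input $\mathcal E_{\rm dyn}(C_b,p,S_T)$ holds for $\{F_n\}$ and $\{z_n^\dagger\}$. There is a universal constant $C>0$ such that, if $0<\eta<1$, $0<\delta_{\rm gram}<1$ and $$N_o\ge C\,L_\star\,\eta^{-2}\log\frac{2r(N+1)}{\delta_{\rm gram}},$$ then, conditional on the feature draw, $$\max_{0\le n\le N}\left\|N_o^{-1}H_n^\top H_n-I_r\right\|_2\le\eta$$ with probability at least $1-\delta_{\rm gram}$ over the sensor locations. On this event, $$\sup_{0\le n\le N}\operatorname{tr}P_n^a\le\frac{r\sigma^2}{N_o(1-\eta)},$$ and, for $\widehat u_n=\Psi^\top m_n^a$, $$\sup_{0\le n\le N}\mathbb E\!\left[\|\widehat u_n-u^\star(\cdot,t_n)\|_{L^2(\Omega)}^2\;\middle|\;\{H_k\}_{k=0}^N\right]\le C_T\left[\varepsilon_{M,\tau}(u^\star)^2+(\Delta t)^{2p}+\frac{r\sigma^2}{N_o(1-\eta)}\right],$$ where the expectation is over the observation noises $\{\xi_k\}_{k=0}^N$ (the feature draw being fixed). The constant $C_T$ depends on $T$, $S_T$ and $C_b$, but not on $N_o$ or $\sigma$; it is independent of $r$ if $C_b$ and $S_T$ are uniform over the effective-rank spaces. If, over the random feature draw, the approximation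 event and the leverage event have failure probabilities $\delta_{\rm app}$ and $\delta_{\rm lev}$ respectively, then the joint success probability over the feature draw and the observation locations (that is, the probability that the approximation event, the leverage event and the empirical Gram event $\max_{0\le n\le N}\|N_o^{-1}H_n^\top H_n-I_r\|_2\le\eta$ all hold) is at least $1-\delta_{\rm app}-\delta_{\rm lev}-\delta_{\rm gram}$.
   Context: Domain and PDE. $\Omega\subset\mathbb R^d$ is a bounded domain with $C^{1,1}$ boundary and $d\mu_\Omega(x)=|\Omega|^{-1}dx$ is normalized volume measure; all $L^2(\Omega)$ norms and inner products are with respect to $\mu_\Omega$. $u^\star$ is the exact solution of the homogeneous heat equation $\partial_t u^\star=\nu\Delta u^\star$ on $\Omega\times(0,T]$, $u^\star|_{\partial\Omega}=0$, $u^\star(\cdot,0)=u_0\in L^2(\Omega)$, with fixed $\nu>0$. The time grid is $t_n=n\Delta t$, $0\le n\le N$, $T=N\Delta t$, $\Delta t>0$. Mass-whitened effective-rank feature space. $\varphi_1,\dots,\varphi_M$ are real functions on $\Omega$ (a random feature draw, frozen once drawn, taken with pointwise representatives), $\Phi=(\varphi_1,\dots,\varphi_M)^\top$. The mass matrix is $\mathbb M_{ij}=\int_\Omega\varphi_i\varphi_j\,d\mu_\Omega$, with eigendecomposition $\mathbb M=V\Lambda V^\top$, $\Lambda=\operatorname{diag}(\lambda_1,\dots,\lambda_M)$, $\lambda_1\ge\dots\ge\lambda_M\ge0$. For a tolerance $\tau\ge0$ let $I_\tau=\{j:\lambda_j>\tau\lambda_1\}$ and $r=|I_\tau|$, assumed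 $\ge1$; $V_\tau,\Lambda_\tau$ contain the retained eigenvectors and eigenvalues, $T_\tau=V_\tau\Lambda_\tau^{-1/2}\in\mathbb R^{M\times r}$, and $\Psi=(\psi_1,\dots,\psi_r)^\top=T_\tau^\top\Phi$. Thus $\int_\Omega\Psi\Psi^\top d\mu_\Omega=I_r$. Approximation event with constant $\varepsilon_{M,\tau}(u^\star)$: there exist coefficients $z_n^\dagger\in\mathbb R^r$, $0\le n\le N$, with $\sup_{0\le n\le N}\|u^\star(\cdot,t_n)-\Psi^\top z_n^\dagger\|_{L^2(\Omega)}\le\varepsilon_{M,\tau}(u^\star)$. Such coefficients are fixed. Leverage event: $L_\tau\le L_\star$, where $L_\tau=\operatorname{ess\,sup}_{x\in\Omega}\|\Psi(x)\|_2^2$ (with respect to $\mu_\Omega$) and $L_\star\ge r$ is a deterministic level. Dynamics input $\mathcal E_{\rm dyn}(C_b,p,S_T)$, with fixed $C_b>0$, $p>0$, $S_T\ge1$: $F_n\in\mathbb R^{r\times r}$, $0\le n<N$, are the forecast matrices; with $b_{n+1}=z_{n+1}^\dagger-F_nz_n^\dagger$ and $\mathcal F_{n:m}=F_{n-1}F_{n-2}\cdots F_m$ for $m<n$, $\mathcal F_{n:n}=I_r$, one has $\|\mathcal F_{n:m}\|_2\le S_T$ for $0\le m\le n\le N$ and $\|b_{n+1}\|_2\le C_b\Delta t\,(\varepsilon_{M,\tau}(u^\star)+(\Delta t)^p)$ for $0\le n<N$. Reference trajectory and data. $\bar z_0=z_0^\dagger$, $\bar z_{n+1}=F_n\bar z_n$.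 At each analysis time $n=0,\dots,N$, sensor locations $X_{n,1},\dots,X_{n,N_o}$ are drawn independently from $\mu_\Omega$, independently across $n$ and independently of the feature draw, and $(H_n)_{ia}=\psi_a(X_{n,i})$, $H_n\in\mathbb R^{N_o\times r}$. The data are $y_n=H_n\bar z_n+\xi_n$ with independent $\xi_n\sim\mathcal N(0,\sigma^2I_{N_o})$, $\sigma>0$ (independent of features and sensors). Kalman filter. Initial forecast mean $m_0^f=\bar z_0$ and initial forecast covariance $P_0^f$; for $0\le n\le N$, $K_n=P_n^fH_n^\top(H_nP_n^fH_n^\top+\sigma^2I_{N_o})^{-1}$, $m_n^a=m_n^f+K_n(y_n-H_nm_n^f)$, $P_n^a=(I-K_nH_n)P_n^f(I-K_nH_n)^\top+\sigma^2K_nK_n^\top$; for $0\le n<N$, $m_{n+1}^f=F_nm_n^a$, $P_{n+1}^f=F_nP_n^aF_n^\top+Q_n$ with $Q_n\succeq0$ prescribed. All forecast covariances are assumed positive definite, $P_n^f\succ0$. *)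

(* Defs.v *)
From HB Require Import structures.
From mathcomp Require Import all_boot all_order all_algebra.
From mathcomp Require Import all_classical all_reals all_analysis.
From mathcomp Require Import measurable_realfun ess_sup_inf.

Set Implicit Arguments.
Unset Strict Implicit.
Unset Printing Implicit Defensive.

Import Order.TTheory GRing.Theory Num.Theory.
Import numFieldNormedType.Exports.

Local Open Scope classical_set_scope.
Local Open Scope ring_scope.

(* Lebesgue measure on R^n, with the Borel sigma-algebra (generated by the
   open sets) on ['rV[R]_n].  It is built as an iterated product of
   [lebesgue_measure], transported along (x, v) |-> row_mx x v. *)

HB.instance Definition _ (R : realType) (n : nat) :=
  Measurable.copy 'rV[R]_n (g_sigma_algebraType (@open 'rV[R]_n)).

Section rV_borel.
Context (R : realType).

Lemma open_measurable_rV n (A : set 'rV[R]_n) : open A -> measurable A.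
Proof. exact: sub_sigma_algebra. Qed.

Lemma measurable_coord n (i : 'I_n) :
  measurable_fun [set: 'rV[R]_n] (fun v => v 0 i).
Proof.
apply: (measurability _ (measurable_realfun.RGenOInfty.measurableE R)).
move=> _ [_ [a ->] <-]; rewrite setTI; apply: open_measurable_rV.
apply: open_comp; last exact: interval_open.
by move=> v _; exact: coord_continuous.
Qed.

Lemma rV_open_bigcup_ball n (U : set 'rV[R]_n) : open U ->
  U = \bigcup_(p in [set p : 'rV[rat]_n * nat |
         ball (map_mx ratr p.1 : 'rV[R]_n) p.2.+1%:R^-1 `<=` U])
       ball (map_mx ratr p.1 : 'rV[R]_n) p.2.+1%:R^-1.
Proof.
move=> oU; apply/seteqP; split => [x Ux|x [p] + xp]; last by exact.
have /nbhs_ballP[e /= e0 xeU] := open_nbhs_nbhs (conj oU Ux).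
pose k := (Num.truncn (2 / e)).
have ke : 2 / k.+1%:R < e.
  rewrite ltr_pdivrMr// mulrC -ltr_pdivrMr//.
  by rewrite truncnS_gt.
have k0 : 0 < k.+1%:R^-1 :> R by rewrite invr_gt0.
have /choice[q qP] : forall i : 'I_n, exists q : rat,
    `|x 0 i - ratr q| < k.+1%:R^-1.
  move=> i.
  have := @rat_in_itvoo R (x 0 i - k.+1%:R^-1) (x 0 i + k.+1%:R^-1).
  rewrite ltrD2l gtrN// => /(_ isT)[q].
  by rewrite in_itv/= -ltr_distl distrC; exists q.
have B : ball (map_mx ratr (\row_i q i) : 'rV[R]_n) k.+1%:R^-1 x.
  by split=> // i j; rewrite !mxE ord1 /ball/= distrC.
exists (\row_i q i, k) => //= y /= qy.
apply: xeU; move: ke; rewrite mulr_natl mulr2n => ke.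
apply: le_ball (ltW ke) _ _.
exact: ball_triangle (ball_sym B) qy.
Qed.

Lemma measurable_fun_rV d (T : measurableType d) n (f : T -> 'rV[R]_n) :
  (forall i, measurable_fun [set: T] (fun x => f x 0 i)) ->
  measurable_fun [set: T] f.
Proof.
move=> mf; apply: (@measurability _ _ _ _ _ _ (@open 'rV[R]_n)) => //.
move=> _ [U oU <-]; rewrite setTI (rV_open_bigcup_ball oU) preimage_bigcup.
rewrite bigcup_mkcond; apply: countable_bigcupT_measurable => // -[q k].
case: ifP => // _ /=.
pose c : 'rV[R]_n := map_mx ratr q.
rewrite (_ : _ @^-1` _ =
  \bigcap_(i in [set: 'I_n]) ((fun x => f x 0 i) @^-1` ball (c 0 i) k.+1%:R^-1)).
  apply: fin_bigcap_measurable => // i _.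
  rewrite -[X in measurable X]setTI; apply: mf => //.
  by apply: open_measurable; exact: ball_open.
apply/seteqP; split => [x /= [_ xq] i _|x /= xq]; first exact: xq.
by split => // i j; rewrite ord1; exact: xq.
Qed.

Definition rV_cons n (p : R * 'rV[R]_n) : 'rV[R]_n.+1 :=
  row_mx (const_mx p.1 : 'rV_1) p.2.

Definition rV_uncons n (v : 'rV[R]_n.+1) : R * 'rV[R]_n :=
  (v 0 0, rsubmx (v : 'rV_(1 + n))).

Lemma measurable_rV_cons n : measurable_fun [set: R * 'rV[R]_n] (@rV_cons n).
Proof.
apply: measurable_fun_rV => i; rewrite /rV_cons.
have [j ij|j ij] := @split_ordP 1 n i.
  rewrite (_ : (fun _ => _) = fst); first exact: measurable_fst.
  by apply/funext => p; rewrite ij (row_mxEl (const_mx p.1 : 'rV_1)) mxE.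
rewrite (_ : (fun _ => _) = (fun v : 'rV[R]_n => v 0 j) \o snd).
  by apply: measurableT_comp; [exact: measurable_coord|exact: measurable_snd].
by apply/funext => p; rewrite ij (row_mxEr (const_mx p.1 : 'rV_1)).
Qed.

Lemma measurable_rV_uncons n : measurable_fun [set: 'rV[R]_n.+1] (@rV_uncons n).
Proof.
apply: measurable_fun_pair; first exact: measurable_coord.
apply: measurable_fun_rV => i; under eq_fun do rewrite mxE.
exact: measurable_coord.
Qed.

Lemma rV_consK n : cancel (@rV_cons n) (@rV_uncons n).
Proof.
move=> [x v]; rewrite /rV_cons /rV_uncons; congr pair => /=.
  have -> : (0 : 'I_n.+1) = lshift n (0 : 'I_1) by apply: val_inj.
  by rewrite (row_mxEl (const_mx x : 'rV_1)) mxE.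
by rewrite row_mxKr.
Qed.

Section lebesgue_step.
Variables (n : nat) (m : {sigma_finite_measure set 'rV[R]_n -> \bar R}).

Definition lebesgue_rV_step : set 'rV[R]_n.+1 -> \bar R :=
  pushforward (lebesgue_measure \x m)%E (@rV_cons n).


Let step0 : lebesgue_rV_step set0 = 0%E.
Proof. by rewrite /lebesgue_rV_step /pushforward preimage_set0 measure0. Qed.

Let mstep A : measurable A -> measurable (@rV_cons n @^-1` A).
Proof. by rewrite -[X in _ -> measurable X]setTI; exact: measurable_rV_cons. Qed.

Let step_ge0 A : (0 <= lebesgue_rV_step A)%E.
Proof. by rewrite /lebesgue_rV_step /pushforward measure_ge0. Qed.

Let step_sigma_additive : semi_sigma_additive lebesgue_rV_step.
Proof.
move=> F mF tF mUF; rewrite /lebesgue_rV_step /pushforward preimage_bigcup.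
apply: measure_semi_sigma_additive.
- by move=> k; exact: mstep.
- apply/trivIsetP => /= i j _ _ ij; rewrite -preimage_setI.
  by move/trivIsetP : tF => /(_ _ _ _ _ ij) ->//; rewrite preimage_set0.
- by rewrite -preimage_bigcup; exact: mstep.
Qed.

HB.instance Definition _ := isMeasure.Build _ _ _ lebesgue_rV_step
  step0 step_ge0 step_sigma_additive.

Let step_sigma_finite : sigma_finite setT lebesgue_rV_step.
Proof.
have [F UF mF] := @sigma_finiteT _ _ _ (@lebesgue_measure R).
have [G UG mG] := sigma_finiteT m.
have [p /= pP] : exists p : nat -> nat * nat, forall q, exists k, p k = q.
  exists (fun k => odflt (0%N, 0%N) (unpickle k)) => q.
  by exists (pickle q); rewrite pickleK.
exists (fun k => @rV_uncons n @^-1` (F (p k).1 `*` G (p k).2)).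
  rewrite -preimage_bigcup; apply/esym; rewrite -subTset => v _ /=.
  have : [set: R] (v 0 0) by [].
  rewrite UF => -[i _ Fi].
  have : [set: 'rV[R]_n] (rV_uncons v).2 by [].
  by rewrite UG => -[j _ Gj]; have [k pk] := pP (i, j); exists k; rewrite ?pk.
move=> k; have [mFk Fk] := mF (p k).1; have [mGk Gk] := mG (p k).2; split.
  rewrite -[X in measurable X]setTI; apply: measurable_rV_uncons => //.
  exact: measurableX.
rewrite /lebesgue_rV_step /pushforward -comp_preimage.
rewrite (_ : _ \o _ = id); last by apply/funext; exact: rV_consK.
by rewrite preimage_id product_measure1E// lte_mul_pinfty// ge0_fin_numE.
Qed.

HB.instance Definition _ := Measure_isSigmaFinite.Build _ _ _ lebesgue_rV_step
  step_sigma_finite.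
End lebesgue_step.

Fixpoint lebesgue_rV n : {sigma_finite_measure set 'rV[R]_n -> \bar R} :=
  if n is k.+1 then lebesgue_rV_step (lebesgue_rV k) else \d_(0 : 'rV[R]_0).
End rV_borel.

Section domain.
Context (R : realType).

Definition C11_function n (g : 'rV[R]_n -> R) :=
  (forall x, differentiable g x) /\
  exists K : R, forall x y v,
    `|'D_v g x - 'D_v g y| <= K * `|x - y| * `|v|.

(* Near each boundary point and after a change of orthonormal coordinates,
   A is the strict epigraph of a C^{1,1} function of the first d variables. *)
Definition C11_boundary d (A : set 'rV[R]_d.+1) :=
  forall x0, (closure A `\` interior A) x0 ->
  exists (rho : R) (U : 'M[R]_d.+1) (g : 'rV[R]_d -> R),
    [/\ 0 < rho, U *m U^T = 1%:M, C11_function g &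
      forall x, ball x0 rho x ->
        (A x <-> g (col' ord_max (x *m U)) < (x *m U) 0 ord_max)].

(* The space dimension is d.+1, so that it is at least 1. *)
Record C11_domain (d : nat) := C11Domain {
  dom_set :> set 'rV[R]_d.+1;
  dom_open : open dom_set;
  dom_nonempty : dom_set !=set0;
  dom_connected : connected dom_set;
  dom_bounded : bounded_set dom_set;
  dom_boundary : C11_boundary dom_set }.

Arguments dom_open {d} c.

Section normalized_volume.
Variables (d : nat) (Omega : C11_domain d).

Lemma inv_volume_ge0 : 0 <= (fine (lebesgue_rV R d.+1 Omega))^-1.
Proof. by rewrite invr_ge0 fine_ge0. Qed.

Definition normalized_volume : {measure set 'rV[R]_d.+1 -> \bar R} :=
  mscale (NngNum inv_volume_ge0)
    (mrestr (lebesgue_rV R d.+1) (open_measurable_rV (dom_open Omega))).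

End normalized_volume.

End domain.

Section L2.
Local Open Scope ereal_scope.
Context d (T : measurableType d) (R : realType).
Variable mu : {measure set T -> \bar R}.

Definition L2norm (f : T -> R) : \bar R := 'N[mu]_2%:E[EFin \o f].

Definition in_L2 (f : T -> R) :=
  measurable_fun [set: T] f /\ L2norm f < +oo.

End L2.

Section heat_equation.
Context (R : realType) (d : nat) (dom : C11_domain R d).
Local Notation point := 'rV[R]_d.+1.
Local Notation Omega := (dom_set dom).
Local Notation mu := (normalized_volume dom).

Definition laplacian (f : point -> R) (x : point) : R :=
  \sum_(i < d.+1) 'D_('e_i) ('D_('e_i) f) x.

(* Classical solution for t > 0, continuous up to the boundary, which attains
   its L^2 initial datum in the L^2 sense.  Functions on Omega are total
   functions on R^(d+1); only their values on Omega (for the boundary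
   condition: on its closure) matter.  The time derivative at t is the limit
   of the difference quotients with times in ]0, T], hence one-sided at T. *)
Definition heat_solution (nu T : R) (u0 : point -> R) (u : R -> point -> R) :=
  [/\ in_L2 mu u0 /\ (forall t, 0 <= t <= T -> in_L2 mu (u t)),
      (forall x, Omega x -> u 0 x = u0 x) /\
        L2norm mu (u t \- u0) @[t --> within `]0, T]%classic (nbhs 0)] --> 0%E,
      {within `]0, T]%classic `*` closure Omega,
        continuous (fun p : R * point => u p.1 p.2)},
      (forall t x, 0 < t <= T -> (closure Omega `\` Omega) x -> u t x = 0) &
      forall t x, 0 < t <= T -> Omega x ->
        (forall i : 'I_d.+1, derivable (u t) x 'e_i /\
                             derivable ('D_('e_i) (u t)) x 'e_i) /\
        (s - t)^-1 * (u s x - u t x)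
          @[s --> within `]0, T]%classic t^'] --> nu * laplacian (u t) x].

End heat_equation.

Section euclidean.
Context (R : realType).

Definition norm2 n (v : 'cV[R]_n) : R := Num.sqrt (\sum_(i < n) v i 0 ^+ 2).

Definition opnorm2 m n (A : 'M[R]_(m, n)) : R :=
  sup [set norm2 (A *m v) | v in [set v : 'cV[R]_n | norm2 v <= 1]].

Definition possemidef n (A : 'M[R]_n) :=
  A^T = A /\ forall v : 'cV[R]_n, 0 <= (v^T *m A *m v) 0 0.

Definition posdef n (A : 'M[R]_n) :=
  A^T = A /\ forall v : 'cV[R]_n, v != 0 -> 0 < (v^T *m A *m v) 0 0.

Definition sorted_eigendecomposition n (A V : 'M[R]_n) (lam : 'rV[R]_n) :=
  [/\ V^T *m V = 1%:M, A = V *m diag_mx lam *m V^T,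
      (forall i j : 'I_n, (i <= j)%N -> lam 0 j <= lam 0 i) &
      forall i, 0 <= lam 0 i].

End euclidean.

Section features.
Context d (T : measurableType d) (R : realType).
Variable mu : {measure set T -> \bar R}.

Definition mass_matrix n (phi : 'I_n -> T -> R) : 'M[R]_n :=
  \matrix_(i, j) (\int[mu]_x (phi i x * phi j x)).

(* lam 0 0 is the largest eigenvalue. *)
Definition retained m (lam : 'rV[R]_m.+1) (tau : R) : {set 'I_m.+1} :=
  [set j | tau * lam 0 0 < lam 0 j].

(* A draw of M = m.+1 features, with an eigendecomposition of its mass matrix
   and effective rank at least 1. *)
Record feature_space (m : nat) (tau : R) := FeatureSpace {
  feature : 'I_m.+1 -> T -> R;
  eigvecs : 'M[R]_m.+1;
  eigvals : 'rV[R]_m.+1;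
  feature_L2 : forall j, in_L2 mu (feature j);
  eigenP : sorted_eigendecomposition (mass_matrix feature) eigvecs eigvals;
  retained_gt0 : (0 < #|retained eigvals tau|)%N }.

Section whitened.
Context m tau (fs : feature_space m tau).

Definition eff_rank : nat := #|retained (eigvals fs) tau|.

Definition whitening : 'M[R]_(m.+1, eff_rank) :=
  colsub (@enum_val _ (mem (retained (eigvals fs) tau))) (eigvecs fs) *m
  diag_mx (\row_a (Num.sqrt (eigvals fs 0 (enum_val a)))^-1).

Definition Psi (x : T) : 'cV[R]_eff_rank :=
  whitening^T *m \col_j feature fs j x.

Definition synthesis (z : 'cV[R]_eff_rank) (x : T) : R := ((Psi x)^T *m z) 0 0.

Definition leverage : \bar R := ess_sup mu (fun x => (norm2 (Psi x) ^+ 2)%:E).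

Definition approximates (u : R -> T -> R) (dt : R) (N : nat) (eps : R)
    (z : nat -> 'cV[R]_eff_rank) :=
  forall n, (n <= N)%N ->
    (L2norm mu (u (n%:R * dt)%R \- synthesis (z n))%R <= eps%:E)%E.

Definition sensor_matrix No (x : 'I_No -> T) : 'M[R]_(No, eff_rank) :=
  \matrix_(i, a) Psi (x i) a 0.

Definition gram_event (N No : nat) (eta : R) (x : nat -> 'I_No -> T) :=
  forall n, (n <= N)%N ->
    let H := sensor_matrix (x n) in
    opnorm2 (No%:R^-1 *: (H^T *m H) - 1%:M) <= eta.

(* The number of sensors required at accuracy eta and confidence delta. *)
Definition sample_size (C Lstar eta delta : R) (N : nat) : R :=
  C * Lstar * eta ^- 2 * ln (2 * eff_rank%:R * N.+1%:R / delta).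

End whitened.
End features.

Section dynamics.
Context (R : realType) (r : nat).
Variable F : nat -> 'M[R]_r.

(* F_(n-1) *m ... *m F_m *)
Definition propagator (n m : nat) : 'M[R]_r :=
  \big[mulmx/1%:M]_(k <- rev (index_iota m n)) F k.

Definition dynamics_input (z : nat -> 'cV[R]_r) (N : nat)
    (dt eps Cb p ST : R) :=
  (forall m n, (m <= n <= N)%N -> opnorm2 (propagator n m) <= ST) /\
  (forall n, (n < N)%N ->
     norm2 (z n.+1 - F n *m z n) <= Cb * dt * (eps + dt `^ p)).

Fixpoint reference (z0 : 'cV[R]_r) (n : nat) : 'cV[R]_r :=
  if n is k.+1 then F k *m reference z0 k else z0.

End dynamics.

Section kalman.
Context (R : realType) (r No : nat).
Variables (F Q : nat -> 'M[R]_r) (sigma : R) (P0 : 'M[R]_r).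
Variable H : nat -> 'M[R]_(No, r).

Definition gain (P : 'M[R]_r) (n : nat) : 'M[R]_(r, No) :=
  P *m (H n)^T *m invmx (H n *m P *m (H n)^T + (sigma ^+ 2)%:M).

Definition analysis_update (P : 'M[R]_r) (n : nat) : 'M[R]_r :=
  let K := gain P n in
  (1%:M - K *m H n) *m P *m (1%:M - K *m H n)^T + sigma ^+ 2 *: (K *m K^T).

Fixpoint forecast_cov (n : nat) : 'M[R]_r :=
  if n is k.+1 then
    F k *m analysis_update (forecast_cov k) k *m (F k)^T + Q k
  else P0.

Definition analysis_cov (n : nat) := analysis_update (forecast_cov n) n.

Variables (m0 : 'cV[R]_r) (y : nat -> 'cV[R]_No).

Definition mean_update (mf : 'cV[R]_r) (n : nat) : 'cV[R]_r :=
  mf + gain (forecast_cov n) n *m (y n - H n *m mf).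

Fixpoint forecast_mean (n : nat) : 'cV[R]_r :=
  if n is k.+1 then F k *m mean_update (forecast_mean k) k else m0.

Definition analysis_mean (n : nat) := mean_update (forecast_mean n) n.

End kalman.

Section randomness.
Context d d' (S : measurableType d) (E : measurableType d') (R : realType).
Variable P : probability S R.

(* Taking some B i to be the full space gives the product rule for every
   subfamily. *)
Definition mutually_independent (I : finType) (X : I -> S -> E) :=
  forall B : I -> set E, (forall i, measurable (B i)) ->
    P (\bigcap_(i in [set: I]) (X i @^-1` B i)) =
    (\prod_(i : I) P (X i @^-1` B i))%E.

Definition has_law (X : S -> E) (law : set E -> \bar R) :=
  forall B, measurable B -> P (X @^-1` B) = law B.

End randomness.

(* Main.v *)
(* Concentration of the Gram matrix.  Let S = n^-1 sum_i Z_i - I, where the Z_i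
   are independent rank-one matrices with mean I and norm at most L, let Z_0 be
   an independent copy, and let S_i be S with Z_i replaced by Z_0.  By
   exchangeability,
     E tr S^(2k+2) = (2n)^-1 sum_i E tr ((Z_i - Z_0) (S^(2k+1) - S_i^(2k+1))),
   and S - S_i = n^-1 (Z_i - Z_0), so a mean value inequality for the trace and
   (Z_i - Z_0)^2 <= 2L (Z_i + Z_0) bound the right-hand side by
     (2k+1) (L/n) E (2 tr S^(2k) + tr S^(2k+1)).
   Hence E tr S^(2p) <= r (10 p L / n)^p as long as 2 p L <= n, and Markov's
   inequality with p of order log (2 r (N+1) / delta) gives the tail.

   Filter.  In Joseph form the Kalman gain minimizes the trace of the analysis
   covariance, so the latter is at most that of the least-squares gain
   (H^T H)^-1 H^T, which is sigma^2 tr (H^T H)^-1.  The error of the filter mean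
   is linear in the noises, with a covariance dominated by the analysis
   covariance. *)
Require Import Defs.
From HB Require Import structures.
From mathcomp Require Import all_boot all_order all_algebra.
From mathcomp Require Import all_classical all_reals all_analysis.
From mathcomp Require Import perm measurable_realfun ess_sup_inf zify ring lra.

Set Implicit Arguments.
Unset Strict Implicit.
Unset Printing Implicit Defensive.

Import Order.TTheory GRing.Theory Num.Theory.
Import numFieldNormedType.Exports.

Local Open Scope classical_set_scope.
Local Open Scope ring_scope.

(** * Trace inequalities for symmetric matrices *)

Section trace_inequalities.
Context (R : realFieldType).

(** Traces of powers, unlike a matrix exponential, keep every random quantity a polynomial in
    bounded entries, so all expectations are scalar integrals of bounded functions. The price is
    that the deviation S is symmetric but not positive, so its odd powers carry no sign. The moments
    therefore advance in steps of two, the mean value inequality is arranged so that only even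
    powers remain on its right-hand side, and the odd moment left by the recursion is absorbed
    through tr (S^(2k) (1 - S)^2) >= 0. The leverage bounds the features only almost everywhere,
    while the moment argument uses a bound at every point. It is run on features truncated to 0 at
    the exceptional points, which agree almost surely with the true ones at all sensors. The trace
    bound on the analysis covariance is deterministic once the Gram event holds. The law of the
    noise enters only the mean square error, through the bound 16 sigma^2 on its second moment, and
    the factor 16 ends up in C_T. *)

Lemma subrXX_telescope (A : pzRingType) (x y : A) q :
  x ^+ q - y ^+ q = \sum_(j < q) x ^+ j * (x - y) * y ^+ (q - j.+1).
Proof.
elim: q => [|q IHq]; first by rewrite big_ord0 subrr.
rewrite big_ord_recr /= subnn expr0 mulr1 mulrBr -exprSr.
under eq_bigr => j _ do rewrite (subSn (ltn_ord j)) exprSr mulrA.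
by rewrite -mulr_suml -IHq mulrBl -exprSr addrC addrA subrK.
Qed.

Lemma trmx_exp n (A : 'M[R]_n) k : (A ^+ k)^T = A^T ^+ k.
Proof.
elim: k => [|k IHk]; first by rewrite !expr0 trmx1.
by rewrite exprS exprSr -!mulmxE trmx_mul IHk.
Qed.

Lemma mxtrace_trmulE m n (A B : 'M[R]_(m, n)) :
  \tr (A^T *m B) = \sum_j \sum_i A i j * B i j.
Proof. by apply: eq_bigr => j _; rewrite mxE; apply: eq_bigr => i _; rewrite mxE. Qed.

Lemma mxtrace_trmul_ge0 m n (A : 'M[R]_(m, n)) : 0 <= \tr (A^T *m A).
Proof.
rewrite mxtrace_trmulE; apply: sumr_ge0 => j _; apply: sumr_ge0 => i _.
by rewrite -expr2 sqr_ge0.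
Qed.

Lemma mxtraceB n (A B : 'M[R]_n) : \tr (A - B) = \tr A - \tr B.
Proof. exact: raddfB. Qed.

Lemma mxtrace_AGM m n (A B : 'M[R]_(m, n)) :
  2 * \tr (A^T *m B) <= \tr (A^T *m A) + \tr (B^T *m B).
Proof.
have := mxtrace_trmul_ge0 (A - B).
have -> : (A - B)^T = A^T - B^T by rewrite linearB.
rewrite mulmxBl !mulmxBr !raddfB /= -(mxtrace_tr (B^T *m A)).
rewrite trmx_mul trmxK; lra.
Qed.

Lemma mxtrace_conj_ge0 m n (M : 'M[R]_m) (B : 'M[R]_(m, n)) :
  (forall v : 'cV[R]_m, 0 <= (v^T *m M *m v) 0 0) -> 0 <= \tr (B^T *m M *m B).
Proof.
move=> M0; apply: sumr_ge0 => j _.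
suff -> : (B^T *m M *m B) j j = ((col j B)^T *m M *m col j B) 0 0 by [].
by rewrite tr_col -row_mul colE mulmxA -colE -row_mul !mxE.
Qed.

(** A convex sequence lies below its chord from 0 to i+1, evaluated here at i and cleared of
    denominators. *)
Lemma ler_convex_seq (b : nat -> R) k :
  (forall i, (i.+2 <= k)%N -> 2 * b i.+1 <= b i + b i.+2) ->
  forall i, (i < k)%N -> i.+1%:R * b i <= b 0%N + i%:R * b i.+1.
Proof.
move=> cvx; elim=> [|i IHi] ik; first by rewrite mul0r addr0 mul1r.
have := IHi (ltnW ik); have := cvx i ik.
have : 0 <= i%:R :> R by []; rewrite -!natr1; nra.
Qed.

(** The trace a_j of D W^j D Y^(2k-j) has the Gram form a_(i+j) = tr (c_i^T c_j), so a_(i+j) is at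
    most the mean of a_(2i) and a_(2j). Hence the even terms form a convex sequence and each odd
    term is at most the mean of its two neighbours, which bounds the average of all terms by the
    mean of the two end terms. These contain only the even powers W^(2k) and Y^(2k). *)
Lemma ler_mxtrace_sum_expr n (D W Y : 'M[R]_n) k :
  D^T = D -> W^T = W -> Y^T = Y ->
  2 * \sum_(j < k.*2.+1) \tr (D * W ^+ j * D * Y ^+ (k.*2 - j)) <=
  k.*2.+1%:R * (\tr (D ^+ 2 * W ^+ k.*2) + \tr (D ^+ 2 * Y ^+ k.*2)).
Proof.
move=> sD sW sY.
pose c i : 'M[R]_n := W ^+ i * D * Y ^+ (k - i).
pose a j := \tr (D * W ^+ j * D * Y ^+ (k.*2 - j)).
pose b i := a i.*2.
have aE i j : (i <= k)%N -> (j <= k)%N -> a (i + j)%N = \tr ((c i)^T *m c j).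
  move=> ik jk; rewrite /a /c -!mulmxE !trmx_mul !trmx_exp sD sW sY !mulmxE.
  have -> : (k.*2 - (i + j) = (k - j) + (k - i))%N by lia.
  rewrite -!mulrA -(mxtrace_mulC _ (Y ^+ (k - i))) mulmxE !exprD.
  by rewrite !mulrA.
have b2 i j : (i <= k)%N -> (j <= k)%N -> 2 * a (i + j)%N <= b i + b j.
  move=> ik jk; rewrite /b -!addnn !aE//; exact: mxtrace_AGM.
have cvx i : (i.+2 <= k)%N -> 2 * b i.+1 <= b i + b i.+2.
  move=> ik; have -> : b i.+1 = a (i + i.+2)%N by rewrite /b; congr a; lia.
  by apply: b2 => //; lia.
(* Passing from l to l+1 adds a_(2l+1) and a_(2l+2). The resulting (2l+2) b_l is replaced by 2 b_0 +
   2l b_(l+1), by the chord inequality. *)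
have sum_le l : (l <= k)%N ->
    2 * \sum_(j < l.*2.+1) a j <= l.*2.+1%:R * (b 0%N + b l).
  elim: l => [|l IHl] lk; first by rewrite big_ord1 mul1r mulr_natl mulr2n.
  rewrite doubleS big_ord_recr big_ord_recr /= !mulrDr.
  have := IHl (ltnW lk); have := ler_convex_seq cvx lk.
  have := b2 l l.+1 (ltnW lk) lk; rewrite addnS addnn -/(b l.+1).
  have -> : l.*2.+3%:R = 2 * l%:R + 3 :> R by rewrite -muln2 -addn3 natrD natrM mulrC.
  have -> : l.*2.+1%:R = 2 * l%:R + 1 :> R by rewrite -muln2 -addn1 natrD natrM mulrC.
  have -> : l.+1%:R = l%:R + 1 :> R by rewrite natr1.
  rewrite -/(b l.+1); lra.
have := sum_le k (leqnn k).
have -> : b 0%N = \tr (D ^+ 2 * Y ^+ k.*2) by rewrite /b /a expr0 mulr1 subn0.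
have -> : b k = \tr (D ^+ 2 * W ^+ k.*2).
  rewrite /b /a subnn expr0 mulr1 -[LHS](mxtrace_mulC D) mulmxE !mulrA //.
by rewrite (addrC (\tr (D ^+ 2 * Y ^+ _))).
Qed.

(* Trace form of the mean value inequality for the odd power x^(2k+1). *)
Lemma ler_mxtrace_subrXX n (D W Y : 'M[R]_n) (c : R) k :
  0 <= c -> D^T = D -> W^T = W -> Y^T = Y -> W - Y = c *: D ->
  2 * \tr (D * (W ^+ k.*2.+1 - Y ^+ k.*2.+1)) <=
  c * k.*2.+1%:R * (\tr (D ^+ 2 * W ^+ k.*2) + \tr (D ^+ 2 * Y ^+ k.*2)).
Proof.
move=> c0 sD sW sY WY; rewrite subrXX_telescope WY.
rewrite -[leRHS]mulrA.
apply: le_trans (ler_wpM2l c0 (ler_mxtrace_sum_expr k sD sW sY)).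
rewrite mulrCA ler_wpM2l// mulr_sumr raddf_sum mulr_sumr ler_sum// => j _.
by rewrite -!mulmxE -scalemxAr -scalemxAl -scalemxAr -[X in X <= _]/(\tr _) mxtraceZ !mulmxA subSS.
Qed.
End trace_inequalities.

(** * Euclidean norm and operator norm *)

Section norms.
Context (R : realType).

Lemma norm2_ge0 n (v : 'cV[R]_n) : 0 <= norm2 v.
Proof. exact: sqrtr_ge0. Qed.

Lemma norm2_sqr n (v : 'cV[R]_n) : norm2 v ^+ 2 = (v^T *m v) 0 0.
Proof.
rewrite sqr_sqrtr; last by apply: sumr_ge0 => i _; rewrite sqr_ge0.
by rewrite mxE; apply: eq_bigr => i _; rewrite mxE expr2.
Qed.

Lemma norm2_sqr_trace n (v : 'cV[R]_n) : norm2 v ^+ 2 = \tr (v^T *m v).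
Proof. by rewrite norm2_sqr /mxtrace big_ord1. Qed.

Lemma norm2_eq0 n (v : 'cV[R]_n) : (norm2 v == 0) = (v == 0).
Proof.
apply/idP/eqP => [|->]; last first.
  by rewrite -sqrf_eq0 norm2_sqr mulmx0 mxE.
rewrite sqrtr_eq0 => v0; apply/colP => i; rewrite mxE; apply/eqP.
rewrite -sqrf_eq0 eq_le sqr_ge0 andbT (le_trans _ v0)//.
rewrite (bigD1 i)//= lerDl sumr_ge0// => j _; exact: sqr_ge0.
Qed.

Lemma norm2_0 n : norm2 (0 : 'cV[R]_n) = 0.
Proof. by apply/eqP; rewrite norm2_eq0. Qed.

Lemma ler_norm2P n m (u : 'cV[R]_n) (v : 'cV[R]_m) (c : R) : 0 <= c ->
  (norm2 u <= c * norm2 v) = (norm2 u ^+ 2 <= c ^+ 2 * norm2 v ^+ 2).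
Proof.
by move=> c0; rewrite -exprMn ler_pXn2r// nnegrE ?mulr_ge0 ?norm2_ge0.
Qed.

Lemma norm2Z n (c : R) (v : 'cV[R]_n) : norm2 (c *: v) = `|c| * norm2 v.
Proof.
apply/eqP; rewrite -(@eqrXn2 _ 2)// ?mulr_ge0 ?norm2_ge0//.
by rewrite exprMn real_normK ?num_real// !norm2_sqr -scalemxAr
  linearZ /= -scalemxAl !mxE mulrA expr2.
Qed.

Lemma norm2N n (v : 'cV[R]_n) : norm2 (- v) = norm2 v.
Proof. by rewrite -scaleN1r norm2Z normrN1 mul1r. Qed.

Lemma dotmx_le n (u v : 'cV[R]_n) : (u^T *m v) 0 0 <= norm2 u * norm2 v.
Proof.
have [->|u0] := eqVneq u 0.
  by rewrite trmx0 mul0mx mxE mulr_ge0// norm2_ge0.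
have [->|v0] := eqVneq v 0.
  by rewrite mulmx0 mxE mulr_ge0// norm2_ge0.
have pu : 0 < norm2 u by rewrite lt_def norm2_ge0 norm2_eq0 u0.
have pv : 0 < norm2 v by rewrite lt_def norm2_ge0 norm2_eq0 v0.
(* Cauchy-Schwarz from the arithmetic-geometric inequality: rescaled by each other's norm, the two
   vectors get equal length. *)
have := mxtrace_AGM (norm2 v *: u) (norm2 u *: v).
rewrite -!norm2_sqr_trace !norm2Z !ger0_norm ?norm2_ge0//.
rewrite -scalemxAr mxtraceZ linearZ /= -scalemxAl mxtraceZ mulrA /mxtrace big_ord1.
set a := norm2 u in pu *; set b := norm2 v in pv *; set c := (_ *m _) 0 0.
have ab : 0 < b * a by rewrite mulr_gt0.
by move=> h; rewrite -(ler_pM2l ab); nra.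
Qed.

Lemma norm2D n (u v : 'cV[R]_n) : norm2 (u + v) <= norm2 u + norm2 v.
Proof.
rewrite -(@ler_pXn2r _ 2)// ?nnegrE ?addr_ge0 ?norm2_ge0//.
have vu : (v^T *m u) 0 0 = (u^T *m v) 0 0.
  by rewrite -[v^T *m u]trmxK [LHS]mxE trmx_mul trmxK.
have uvT : (u + v)^T = u^T + v^T by rewrite linearD.
rewrite norm2_sqr uvT mulmxDl !mulmxDr.
have mxD00 (A B : 'M[R]_1) : (A + B) 0 0 = A 0 0 + B 0 0 by rewrite mxE.
by rewrite !mxD00 vu -!norm2_sqr; have := dotmx_le u v; nra.
Qed.

Lemma norm2_mulmx_trace m n (A : 'M[R]_(m, n)) (v : 'cV[R]_n) :
  norm2 (A *m v) ^+ 2 <= \tr (A^T *m A) * norm2 v ^+ 2.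
Proof.
rewrite sqr_sqrtr; last by apply: sumr_ge0 => i _; rewrite sqr_ge0.
rewrite mxtrace_trmulE exchange_big mulr_suml ler_sum// => i _ /=.
have -> : (A *m v) i 0 = (((row i A)^T)^T *m v) 0 0.
  by rewrite trmxK -row_mul [RHS]mxE.
have -> : \sum_j A i j * A i j = norm2 (row i A)^T ^+ 2.
  by rewrite norm2_sqr mxE; apply: eq_bigr => j _; rewrite !mxE.
rewrite -exprMn -ler_sqrt; last by rewrite sqr_ge0.
rewrite !sqrtr_sqr [leRHS]ger0_norm ?mulr_ge0 ?norm2_ge0// ler_norml dotmx_le.
rewrite andbT lerNl; have := dotmx_le (- (row i A)^T) v.
by rewrite linearN /= mulNmx [X in X <= _]mxE norm2N.
Qed.

Lemma norm2_mulmx_opnorm2 m n (A : 'M[R]_(m, n)) (v : 'cV[R]_n) :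
  norm2 (A *m v) <= opnorm2 A * norm2 v.
Proof.
have [->|v0] := eqVneq v 0; first by rewrite mulmx0 !norm2_0 mulr0.
have pv : 0 < norm2 v by rewrite lt_def norm2_ge0 norm2_eq0 v0.
have -> : norm2 (A *m v) = norm2 (A *m ((norm2 v)^-1 *: v)) * norm2 v.
  rewrite -scalemxAr norm2Z ger0_norm ?invr_ge0 ?norm2_ge0//.
  by rewrite mulrAC mulVf ?mul1r// gt_eqF.
rewrite ler_pM2r//; apply: sup_ubound; last first.
  exists ((norm2 v)^-1 *: v) => //=.
  by rewrite norm2Z ger0_norm ?invr_ge0 ?norm2_ge0// mulVf// gt_eqF.
(* The supremum [sup] bounds its elements only when the set is bounded above; the Frobenius norm is
   such a bound. *)
exists (Num.sqrt (\tr (A^T *m A))) => _ [w /= w1 <-].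
rewrite -(@ler_pXn2r _ 2)// ?nnegrE ?norm2_ge0 ?sqrtr_ge0//.
rewrite [leRHS]sqr_sqrtr ?mxtrace_trmul_ge0//.
rewrite (le_trans (norm2_mulmx_trace _ _))//.
by rewrite ler_piMr ?mxtrace_trmul_ge0// expr_le1// norm2_ge0.
Qed.

Lemma opnorm2_leP m n (A : 'M[R]_(m, n)) (c : R) : 0 <= c ->
  (opnorm2 A <= c) <-> (forall v, norm2 (A *m v) <= c * norm2 v).
Proof.
move=> c0; split=> [Ac v|Ac].
  by rewrite (le_trans (norm2_mulmx_opnorm2 _ _))// ler_wpM2r ?norm2_ge0.
apply: ge_sup; first by exists 0, 0; rewrite /= ?mulmx0 norm2_0.
by move=> _ [w /= w1 <-]; rewrite (le_trans (Ac w))// ler_piMr.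
Qed.

(* |S^k v|^2 is log-convex in k, so its first ratio bounds all the others. *)
Lemma sym_opnorm2_trace n (S : 'M[R]_n) (eta : R) p :
  S^T = S -> 0 < eta -> eta < opnorm2 S ->
  eta ^+ p.+1.*2 <= \tr (S ^+ p.+1.*2).
Proof.
move=> sS eta0 etaS.
have [v vS] : exists v, eta * norm2 v < norm2 (S *m v).
  apply/not_existsP => h; move: etaS; rewrite ltNge => /negP; apply.
  apply/(opnorm2_leP _ (ltW eta0)) => v; rewrite leNgt; apply/negP; exact: h.
pose a k := norm2 (S ^+ k *m v) ^+ 2.
have a0 k : 0 <= a k by rewrite sqr_ge0.
have v0 : 0 < a 0%N.
  rewrite /a expr0 mul1mx exprn_gt0// lt_def norm2_ge0 andbT norm2_eq0.
  by apply/eqP => v0; rewrite v0 mulmx0 norm2_0 mulr0 ltxx in vS.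
have cvx k : a k.+1 ^+ 2 <= a k * a k.+2.
  have aE : a k.+1 = ((S ^+ k *m v)^T *m (S ^+ k.+2 *m v)) 0 0.
    rewrite /a norm2_sqr !trmx_mul !trmx_exp sS -!(mulmxA v^T).
    rewrite !(mulmxA (S ^+ _) (S ^+ _) v) !mulmxE -!exprD.
    by rewrite addSnnS.
  have := dotmx_le (S ^+ k *m v) (S ^+ k.+2 *m v).
  by rewrite -aE -exprMn => h; rewrite ler_pXn2r// nnegrE // (le_trans (a0 _) h).
have step k : 0 < a k /\ eta ^+ 2 * a k <= a k.+1.
  elim: k => [|k [ak IHk]].
    split=> //; rewrite /a expr0 mul1mx expr1 -exprMn.
    rewrite ler_pXn2r// ?nnegrE ?norm2_ge0//; first exact: ltW.
    by rewrite mulr_ge0 ?norm2_ge0 ?ltW.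
  have ak1 : 0 < a k.+1 by rewrite (lt_le_trans _ IHk)// mulr_gt0// exprn_gt0.
  split=> //; rewrite -(ler_pM2l ak); apply: le_trans (cvx k).
  by rewrite mulrA (mulrC (a k)) [leRHS]expr2 ler_wpM2r.
have pw k : eta ^+ k.*2 * a 0%N <= a k.
  elim: k => [|k IHk]; first by rewrite expr0 mul1r.
  apply: le_trans (step k).2; rewrite -!mul2n mulnS exprD -mulrA.
  by rewrite mul2n ler_wpM2l// sqr_ge0.
rewrite -(ler_pM2r v0) (le_trans (pw _))// /a expr0 mul1mx.
rewrite (le_trans (norm2_mulmx_trace _ _))//.
by rewrite trmx_exp sS mulmxE -exprD addnn.
Qed.
End norms.

(** * Expectation of bounded measurable functions *)

Section bounded_measurable.
Context d (T : measurableType d) (R : realType).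
Implicit Types f g : T -> R.

(** Closed under the ring operations and integrable for every probability, so polynomials in bounded
    random entries need no separate integrability argument. The bound is required at every point,
    not almost everywhere. *)
Definition bmfun f :=
  measurable_fun [set: T] f /\ exists M, forall x, `|f x| <= M.

Lemma bmfun_cst c : bmfun (cst c).
Proof. by split; [exact: measurable_cst|exists `|c|]. Qed.

Lemma bmfunD f g : bmfun f -> bmfun g -> bmfun (fun x => f x + g x).
Proof.
move=> [mf [M fM]] [mg [N gN]]; split; first exact: measurable_funD.
by exists (M + N) => x; rewrite (le_trans (ler_normD _ _))// lerD.
Qed.

Lemma bmfunM f g : bmfun f -> bmfun g -> bmfun (fun x => f x * g x).
Proof.
move=> [mf [M fM]] [mg [N gN]]; split; first exact: measurable_funM.
by exists (M * N) => x; rewrite normrM ler_pM.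
Qed.

Lemma bmfunZ c f : bmfun f -> bmfun (fun x => c * f x).
Proof. by move=> bf; apply: bmfunM => //; exact: bmfun_cst. Qed.

Lemma bmfunB f g : bmfun f -> bmfun g -> bmfun (fun x => f x - g x).
Proof.
move=> bf bg; apply: bmfunD => //.
by under eq_fun do rewrite -mulN1r; exact: bmfunZ.
Qed.

Lemma bmfun_sum (I : Type) (s : seq I) (h : I -> T -> R) :
  (forall i, bmfun (h i)) -> bmfun (fun x => \sum_(i <- s) h i x).
Proof.
move=> bh; elim: s => [|i s IHs].
  by under eq_fun do rewrite big_nil; exact: bmfun_cst.
by under eq_fun do rewrite big_cons; exact: bmfunD.
Qed.

Definition bmmx m n (A : T -> 'M[R]_(m, n)) := forall i j, bmfun (fun x => A x i j).

Lemma bmmx_cst m n (A : 'M[R]_(m, n)) : bmmx (cst A).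
Proof. by move=> i j; exact: bmfun_cst. Qed.

Lemma bmmxD m n (A B : T -> 'M[R]_(m, n)) :
  bmmx A -> bmmx B -> bmmx (fun x => A x + B x).
Proof.
by move=> bA bB i j; under eq_fun do rewrite mxE; exact: bmfunD.
Qed.

Lemma bmmxB m n (A B : T -> 'M[R]_(m, n)) :
  bmmx A -> bmmx B -> bmmx (fun x => A x - B x).
Proof.
by move=> bA bB i j; under eq_fun do rewrite !mxE; exact: bmfunB.
Qed.

Lemma bmmxZ m n c (A : T -> 'M[R]_(m, n)) :
  bmmx A -> bmmx (fun x => c *: A x).
Proof.
by move=> bA i j; under eq_fun do rewrite mxE; exact: bmfunZ.
Qed.

Lemma bmmx_sum m n (I : Type) (s : seq I) (A : I -> T -> 'M[R]_(m, n)) :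
  (forall i, bmmx (A i)) -> bmmx (fun x => \sum_(i <- s) A i x).
Proof.
move=> bA i j; under eq_fun do rewrite summxE.
by apply: bmfun_sum => k; exact: bA.
Qed.

Lemma bmmxM m n p (A : T -> 'M[R]_(m, n)) (B : T -> 'M[R]_(n, p)) :
  bmmx A -> bmmx B -> bmmx (fun x => A x *m B x).
Proof.
move=> bA bB i j; under eq_fun do rewrite mxE.
by apply: bmfun_sum => k; exact: bmfunM.
Qed.

Lemma bmmxX n (A : T -> 'M[R]_n) k : bmmx A -> bmmx (fun x => A x ^+ k).
Proof.
move=> bA; elim: k => [|k IHk]; first exact: bmmx_cst.
by under [X in bmmx X]eq_fun do rewrite exprS; exact: bmmxM.
Qed.

Lemma bmfun_tr n (A : T -> 'M[R]_n) : bmmx A -> bmfun (fun x => \tr (A x)).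
Proof. by move=> bA; apply: bmfun_sum => i; exact: bA. Qed.

Variable P : probability T R.

Lemma bmfun_integrable f : bmfun f -> P.-integrable [set: T] (EFin \o f).
Proof.
move=> [mf [M fM]]; apply: measurable_bounded_integrable => //.
  by rewrite (le_lt_trans (probability_le1 _ _))// ltry.
by exists M; split => [|N MN x _]; [exact: num_real|]; exact: le_trans (fM x) (ltW MN).
Qed.

Lemma bmE_cst c : \int[P]_x c = c.
Proof. by rewrite Rintegral_cst//= probability_setT mulr1. Qed.

Lemma bmED f g : bmfun f -> bmfun g ->
  \int[P]_x (f x + g x) = \int[P]_x f x + \int[P]_x g x.
Proof. by move=> /bmfun_integrable ? /bmfun_integrable ?; exact: RintegralD. Qed.

Lemma bmEB f g : bmfun f -> bmfun g ->
  \int[P]_x (f x - g x) = \int[P]_x f x - \int[P]_x g x.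
Proof. by move=> /bmfun_integrable ? /bmfun_integrable ?; exact: RintegralB. Qed.

Lemma bmEZ c f : bmfun f -> \int[P]_x (c * f x) = c * \int[P]_x f x.
Proof. by move=> /bmfun_integrable ?; exact: RintegralZl. Qed.

Lemma bmE_sum (I : Type) (s : seq I) (h : I -> T -> R) :
  (forall i, bmfun (h i)) ->
  \int[P]_x (\sum_(i <- s) h i x) = \sum_(i <- s) \int[P]_x h i x.
Proof.
move=> bh; elim: s => [|i s IHs].
  under [X in X = _]eq_Rintegral do rewrite big_nil.
  by rewrite big_nil bmE_cst.
under [X in X = _]eq_Rintegral do rewrite big_cons.
by rewrite big_cons bmED ?IHs//; exact: bmfun_sum.
Qed.

Lemma bmE_le f g : bmfun f -> bmfun g -> (forall x, f x <= g x) ->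
  \int[P]_x f x <= \int[P]_x g x.
Proof.
by move=> /bmfun_integrable ? /bmfun_integrable ? fg; apply: le_Rintegral.
Qed.

End bounded_measurable.

Lemma bmfun_comp d d' (T : measurableType d) (T' : measurableType d')
    (R : realType) (f : T' -> R) (phi : T -> T') :
  measurable_fun [set: T] phi -> bmfun f -> bmfun (fun x => f (phi x)).
Proof.
move=> mphi [mf [M fM]]; split; last by exists M.
exact: (measurableT_comp mf mphi).
Qed.

Lemma bmmx_comp d d' (T : measurableType d) (T' : measurableType d')
    (R : realType) m n (A : T' -> 'M[R]_(m, n)) (phi : T -> T') :
  measurable_fun [set: T] phi -> bmmx A -> bmmx (fun x => A (phi x)).
Proof. by move=> mphi bA i j; exact: (bmfun_comp mphi (bA i j)). Qed.

(** * Moments of the empirical Gram deviation *)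

Section gram_deviation.
Context (R : realType) (T : Type) (r : nat) (g : T -> 'cV[R]_r).

Definition rank_one (t : T) : 'M[R]_r := g t *m (g t)^T.

Definition gram_dev n (x : n.-tuple T) : 'M[R]_r :=
  n%:R^-1 *: \sum_(i < n) rank_one (tnth x i) - 1.

(* Entry 0 of [x] is a spare sample: [resample i x] exchanges it with the
   i-th entry of the tail. *)
Definition resample n (i : 'I_n) (x : n.+1.-tuple T) : n.+1.-tuple T :=
  [tuple tnth x (tperm ord0 (lift ord0 i) j) | j < n.+1].

Lemma rank_oneE t a b : rank_one t a b = g t a 0 * g t b 0.
Proof. by rewrite mxE big_ord1 mxE. Qed.

Lemma trmx_rank_one t : (rank_one t)^T = rank_one t.
Proof. by rewrite trmx_mul trmxK. Qed.

Lemma trmx_gram_dev n (x : n.-tuple T) : (gram_dev x)^T = gram_dev x.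
Proof.
rewrite /gram_dev linearB linearZ /= trmx1 raddf_sum /=.
by under eq_bigr do rewrite trmx_rank_one.
Qed.

Lemma tnth_resample0 n i (x : n.+1.-tuple T) :
  tnth (resample i x) ord0 = tnth x (lift ord0 i).
Proof. by rewrite tnth_mktuple tpermL. Qed.

Lemma tnth_resample n i (x : n.+1.-tuple T) :
  tnth (resample i x) (lift ord0 i) = tnth x ord0.
Proof. by rewrite tnth_mktuple tpermR. Qed.

Lemma tnth_behead_lift n (x : n.+1.-tuple T) (j : 'I_n) :
  tnth [tuple of behead x] j = tnth x (lift ord0 j).
Proof. by rewrite tnth_behead; congr tnth; apply: val_inj; rewrite /= inordK ?ltnS. Qed.

Lemma gram_dev_resample n i (x : n.+1.-tuple T) :
  gram_dev [tuple of behead x] - gram_dev [tuple of behead (resample i x)] =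
  n%:R^-1 *: (rank_one (tnth x (lift ord0 i)) - rank_one (tnth x ord0)).
Proof.
rewrite /gram_dev opprB addrA subrK -scalerBr; congr (_ *: _).
rewrite -sumrB (bigD1 i)//= !tnth_behead_lift tnth_resample big1 ?addr0//.
move=> j ji; rewrite !tnth_behead_lift tnth_mktuple tpermD ?subrr//.
by rewrite (inj_eq (@lift_inj _ _)) eq_sym.
Qed.

(** An even power splits evenly on both sides of M, which turns the trace into that of a congruence
    of M. Positivity of M then passes to the trace although W itself has no sign. *)
Lemma mxtrace_mul_expr (W M : 'M[R]_r) k : W^T = W ->
  \tr (M * W ^+ k.*2) = \tr ((W ^+ k)^T *m M *m W ^+ k).
Proof.
move=> sW; rewrite trmx_exp sW [RHS]mxtrace_mulC mulmxA !mulmxE -exprD addnn.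
by rewrite -mulmxE mxtrace_mulC.
Qed.

Lemma mxtrace_gram_expr (W : 'M[R]_r) m (A : 'M[R]_(m, r)) k : W^T = W ->
  0 <= \tr (A^T *m A * W ^+ k.*2).
Proof.
move=> sW; rewrite mxtrace_mul_expr//.
have := mxtrace_trmul_ge0 (A *m W ^+ k).
by rewrite trmx_mul !mulmxA.
Qed.

(** Expands the nonnegative trace of (1 - W)^2 W^(2k). *)
Lemma mxtrace_odd_expr_le (W : 'M[R]_r) k : W^T = W ->
  2 * \tr (W ^+ k.*2.+1) <= \tr (W ^+ k.*2) + \tr (W ^+ k.*2.+2).
Proof.
move=> sW; have := mxtrace_gram_expr (1 - W) k sW.
have -> : (1 - W)^T = 1 - W by rewrite linearB /= trmx1 sW.
rewrite mulmxE -mulrA !mulrBl !mul1r mulrBr -!exprS !mxtraceB; lra.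
Qed.

(** For rank-one matrices Z and Z', (Z - Z')^2 = 2 Z^2 + 2 Z'^2 - (Z + Z')^2. The last square is
    dropped, and Z^2 is Z times the squared norm of its vector, hence at most L Z. *)
Lemma mxtrace_sqr_rank_oneB (W : 'M[R]_r) (L : R) k t u : W^T = W ->
  norm2 (g t) ^+ 2 <= L -> norm2 (g u) ^+ 2 <= L ->
  \tr ((rank_one t - rank_one u) ^+ 2 * W ^+ k.*2) <=
  2 * L * \tr ((rank_one t + rank_one u) * W ^+ k.*2).
Proof.
move=> sW tL uL.
have sqZ v : rank_one v ^+ 2 = norm2 (g v) ^+ 2 *: rank_one v.
  rewrite expr2 -mulmxE /rank_one mulmxA -(mulmxA (g v)) norm2_sqr.
  by rewrite [X in _ *m X *m _]mx11_scalar mul_mx_scalar -scalemxAl.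
have sq_le v : norm2 (g v) ^+ 2 <= L ->
    \tr (rank_one v ^+ 2 * W ^+ k.*2) <= L * \tr (rank_one v * W ^+ k.*2).
  move=> vL; rewrite sqZ -mulmxE -scalemxAl mxtraceZ ler_wpM2r//.
  by have := mxtrace_gram_expr (g v)^T k sW; rewrite trmxK.
have D0 : 0 <= \tr ((rank_one t + rank_one u) ^+ 2 * W ^+ k.*2).
  have := mxtrace_gram_expr (rank_one t + rank_one u) k sW.
  have -> : (rank_one t + rank_one u)^T = rank_one t + rank_one u.
    by rewrite linearD /= !trmx_rank_one.
  by rewrite expr2 mulmxE.
have -> : (rank_one t - rank_one u) ^+ 2 =
   (rank_one t ^+ 2 + rank_one t ^+ 2) +
   (rank_one u ^+ 2 + rank_one u ^+ 2) - (rank_one t + rank_one u) ^+ 2.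
  rewrite !expr2 !mulrDl !mulrDr !mulNr !mulrN opprK.
  move: (_ * _) (_ * _) (_ * _) (_ * _) => a b c e.
  by apply/matrixP => i j; rewrite !mxE; ring.
have := sq_le _ tL; have := sq_le _ uL.
have trD (A B : 'M[R]_r) : \tr ((A + B) * W ^+ k.*2) =
    \tr (A * W ^+ k.*2) + \tr (B * W ^+ k.*2) by rewrite mulrDl mxtraceD.
have trN (A : 'M[R]_r) : \tr (- A * W ^+ k.*2) = - \tr (A * W ^+ k.*2).
  by rewrite mulNr raddfN.
rewrite !trD trN; lra.
Qed.

End gram_deviation.

Section trace_moments.
Context d (T : measurableType d) (R : realType) (r n : nat).
Variables (g : T -> 'cV[R]_r) (L : R) (rho : probability (n.+1.-tuple T) R).
Hypotheses (n0 : (0 < n)%N) (bg : bmmx g) (gL : forall t, norm2 (g t) ^+ 2 <= L).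
(** The moment recursion sees the sample only through three properties: invariance under exchanging
    the spare entry with any other, independence of the spare entry from the rest, and isotropy.
    They are verified below for a concrete law on tuples. *)
Hypothesis exch : forall (i : 'I_n) (h : n.+1.-tuple T -> R), bmfun h ->
  \int[rho]_x h (resample i x) = \int[rho]_x h x.
Hypothesis fresh : forall (f : T -> R) (h : n.-tuple T -> R), bmfun f -> bmfun h ->
  \int[rho]_x (f (tnth x ord0) * h [tuple of behead x]) =
  \int[rho]_x f (tnth x ord0) * \int[rho]_x h [tuple of behead x].
Hypothesis isotropic : forall a b,
  \int[rho]_x rank_one g (tnth x ord0) a b = (1%:M : 'M[R]_r) a b.

Local Notation Z x j := (rank_one g (tnth x j)).
Let W (x : n.+1.-tuple T) := gram_dev g [tuple of behead x].

Definition trace_moment k := \int[rho]_x \tr (W x ^+ k).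
Local Notation M := trace_moment.

Let sW x : (W x)^T = W x. Proof. exact: trmx_gram_dev. Qed.

Let L0 : 0 <= L.
Proof. exact: le_trans (sqr_ge0 _) (gL point). Qed.

Lemma bmmx_rank_one : bmmx (rank_one g).
Proof.
apply: bmmxM => // i j; under eq_fun do rewrite mxE; exact: bg.
Qed.

Lemma bmmx_gram_dev m : bmmx (@gram_dev R T r g m).
Proof.
apply: bmmxB; last exact: bmmx_cst.
apply: bmmxZ; apply: bmmx_sum => i.
apply: (bmmx_comp _ bmmx_rank_one); exact: measurable_tnth.
Qed.

Let bW : bmmx W.
Proof. exact: (bmmx_comp (@measurable_behead _ T n) (@bmmx_gram_dev n)). Qed.

Let bZ j : bmmx (fun x : n.+1.-tuple T => Z x j).
Proof. by apply: (bmmx_comp _ bmmx_rank_one); exact: measurable_tnth. Qed.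

Lemma bmmx_mulr m (A B : n.+1.-tuple T -> 'M[R]_m) :
  bmmx A -> bmmx B -> bmmx (fun x => A x * B x).
Proof. exact: bmmxM. Qed.

Let bDW i k : bmfun (fun x : n.+1.-tuple T =>
  \tr ((Z x (lift ord0 i) - Z x ord0) * W x ^+ k)).
Proof. by apply: bmfun_tr; apply: bmmx_mulr; [exact: bmmxB|exact: bmmxX]. Qed.

Let bSW i k : bmfun (fun x : n.+1.-tuple T =>
  \tr ((Z x (lift ord0 i) + Z x ord0) * W x ^+ k)).
Proof. by apply: bmfun_tr; apply: bmmx_mulr; [exact: bmmxD|exact: bmmxX]. Qed.

Let bWX k : bmfun (fun x => \tr (W x ^+ k)).
Proof. by apply: bmfun_tr; exact: bmmxX. Qed.

Let bZW k : bmfun (fun x => \tr (Z x ord0 * W x ^+ k)).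
Proof. by apply: bmfun_tr; apply: bmmx_mulr => //; exact: bmmxX. Qed.

(** The spare Z_0 is independent of W and has mean I, so it can be averaged out entry by entry. *)
Lemma fresh_trace k : \int[rho]_x \tr (Z x ord0 * W x ^+ k) = M k.
Proof.
have trE (A B : 'M[R]_r) : \tr (A * B) = \sum_a \sum_b A a b * B b a.
  by apply: eq_bigr => a _; rewrite mxE.
under eq_Rintegral do rewrite trE.
have bZWab a b : bmfun (fun x => Z x ord0 a b * (W x ^+ k) b a).
  by apply: bmfunM; [exact: bZ|exact: bmmxX].
rewrite bmE_sum => [|a]; last by apply: bmfun_sum => b; exact: bZWab.
rewrite /M /mxtrace bmE_sum => [|a]; last exact: bmmxX.
apply: eq_bigr => a _; rewrite bmE_sum//.
have step b : \int[rho]_x (Z x ord0 a b * (W x ^+ k) b a) =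
    (1%:M : 'M[R]_r) a b * \int[rho]_x (W x ^+ k) b a.
  rewrite -isotropic.
  apply: (@fresh (fun t => rank_one g t a b) (fun y => (gram_dev g y ^+ k) b a)).
    exact: bmmx_rank_one.
  exact: (bmmxX k (@bmmx_gram_dev n)).
under eq_bigr do rewrite step.
rewrite (bigD1 a)//= mxE eqxx mul1r big1 ?addr0// => b ba.
by rewrite mxE eq_sym (negbTE ba) mul0r.
Qed.

(** Resampling preserves expectations and flips the sign of D = Z_i - Z_0. Symmetrizing thus turns
    the factor W^(2k+1) into its increment, to which the mean value inequality applies because W
    changes by D / n. *)
Lemma resampling_bound i k :
  \int[rho]_x \tr ((Z x (lift ord0 i) - Z x ord0) * W x ^+ k.*2.+1) <=
  k.*2.+1%:R * L / n%:R *
    \int[rho]_x \tr ((Z x (lift ord0 i) + Z x ord0) * W x ^+ k.*2).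
Proof.
pose h (x : n.+1.-tuple T) := \tr ((Z x (lift ord0 i) - Z x ord0) * W x ^+ k.*2.+1).
pose e (x : n.+1.-tuple T) := \tr ((Z x (lift ord0 i) - Z x ord0) ^+ 2 * W x ^+ k.*2).
pose f (x : n.+1.-tuple T) := \tr ((Z x (lift ord0 i) + Z x ord0) * W x ^+ k.*2).
have be : bmfun e.
  by apply: bmfun_tr; apply: bmmx_mulr; apply: bmmxX => //; exact: bmmxB.
have bh : bmfun h by exact: bDW.
have brs (u : n.+1.-tuple T -> R) : bmfun u -> bmfun (fun x => u (resample i x)).
  apply: bmfun_comp; apply/measurable_fun_tnthP => j.
  under [X in measurable_fun _ X]eq_fun do rewrite /= tnth_mktuple.
  exact: measurable_tnth.
have pw x : 2 * (h x + h (resample i x)) <=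
    n%:R^-1 * k.*2.+1%:R * (e x + e (resample i x)).
  rewrite /h /e tnth_resample tnth_resample0.
  set D := Z x _ - Z x _; rewrite -(opprB (Z x (lift ord0 i))) -/D sqrrN mulNr raddfN.
  rewrite -[X in 2 * X]raddfB /= -mulrBr.
  apply: ler_mxtrace_subrXX => //; last exact: gram_dev_resample.
  by rewrite /D linearB /= !trmx_rank_one.
have le_eh : 2 * \int[rho]_x h x <= n%:R^-1 * k.*2.+1%:R * \int[rho]_x e x.
  have := bmE_le rho (bmfunZ 2 (bmfunD bh (brs _ bh)))
    (bmfunZ (n%:R^-1 * k.*2.+1%:R) (bmfunD be (brs _ be))) pw.
  have bhh := bmfunD bh (brs _ bh); have bee := bmfunD be (brs _ be).
  rewrite (bmEZ _ _ bhh) (bmEZ _ _ bee) (bmED _ bh (brs _ bh)) (bmED _ be (brs _ be)).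
  rewrite !exch//; set a := n%:R^-1 * _; set x := \int[rho]_x _; set y := \int[rho]_x _.
  lra.
have le_ef : \int[rho]_x e x <= 2 * L * \int[rho]_x f x.
  rewrite -(bmEZ _ _ (bSW i k.*2)); apply: bmE_le => //.
    by apply: bmfunZ; exact: bSW.
  by move=> x; exact: mxtrace_sqr_rank_oneB.
rewrite -(@ler_pM2l _ 2)//; apply: le_trans le_eh _.
have c0 : 0 <= n%:R^-1 * k.*2.+1%:R :> R by rewrite mulr_ge0.
apply: le_trans (ler_wpM2l c0 le_ef) _; rewrite le_eqVlt; apply/orP; left; apply/eqP.
rewrite /f; ring.
Qed.

Lemma trace_moment_step k : M k.*2.+2 <=
  k.*2.+1%:R * L / n%:R * (2 * M k.*2 + M k.*2.+1).
Proof.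
have nN0 : n%:R != 0 :> R by rewrite pnatr_eq0 -lt0n.
(* The average of the Z_i is W + I. The contribution of I cancels against Z_0 in the average of Z_i
   - Z_0 and is doubled in the average of Z_i + Z_0. *)
have avg (A : 'M[R]_r) x :
    n%:R^-1 * \sum_(i < n) \tr (Z x (lift ord0 i) * A) = \tr (W x * A) + \tr A.
  rewrite /W /gram_dev mulrBl mul1r mxtraceB subrK -mulmxE -scalemxAl mxtraceZ.
  rewrite mulmx_suml raddf_sum; congr (_ * _).
  by apply: eq_bigr => i _; rewrite tnth_behead_lift.
have -> : M k.*2.+2 = n%:R^-1 * \sum_(i < n)
    \int[rho]_x \tr ((Z x (lift ord0 i) - Z x ord0) * W x ^+ k.*2.+1).
  rewrite -bmE_sum// -bmEZ; last by apply: bmfun_sum => i; exact: bDW.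
  have -> : M k.*2.+2 = \int[rho]_x (\tr (W x ^+ k.*2.+2) + \tr (W x ^+ k.*2.+1)) -
      \int[rho]_x \tr (Z x ord0 * W x ^+ k.*2.+1).
    by rewrite fresh_trace bmED// addrK.
  rewrite -bmEB//; last exact: bmfunD.
  apply: eq_Rintegral => x _.
  rewrite (exprS _ k.*2.+1) -avg.
  under [in RHS]eq_bigr do rewrite mulrBl mxtraceB.
  rewrite sumrB mulrBr sumr_const card_ord -[X in _ - _ * X]mulr_natl.
  by rewrite mulrA mulVf// mul1r.
have -> : 2 * M k.*2 + M k.*2.+1 = n%:R^-1 * \sum_(i < n)
    \int[rho]_x \tr ((Z x (lift ord0 i) + Z x ord0) * W x ^+ k.*2).
  rewrite -bmE_sum// -[RHS]bmEZ; last by apply: bmfun_sum => i; exact: bSW.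
  have -> : 2 * M k.*2 + M k.*2.+1 =
      \int[rho]_x (\tr (W x ^+ k.*2.+1) + \tr (W x ^+ k.*2)) +
      \int[rho]_x \tr (Z x ord0 * W x ^+ k.*2).
    by rewrite fresh_trace bmED// /M; ring.
  rewrite -bmED//; last exact: bmfunD.
  apply: eq_Rintegral => x _.
  rewrite (exprS _ k.*2) -avg.
  under [in RHS]eq_bigr do rewrite mulrDl mxtraceD.
  rewrite big_split /= mulrDr sumr_const card_ord -[X in _ + _ * X]mulr_natl.
  by rewrite mulrA mulVf// mul1r.
rewrite mulrCA ler_wpM2l// mulr_sumr; apply: ler_sum => i _.
exact: resampling_bound.
Qed.

Lemma trace_moment_ge0 k : 0 <= M k.*2.
Proof.
apply: Rintegral_ge0 => x _.
have := mxtrace_gram_expr 1%:M k (sW x).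
by rewrite trmx1 mulmx1 mul1r.
Qed.

(** With q = (2k+1) L / n <= 1, inserting the bound on the odd moment gives (1 - q/2) M_(2k+2) <=
    (5/2) q M_(2k). Since 1 - q/2 >= 1/2, the factor is at most 5q. *)
Lemma trace_moment_contract k : k.*2.+1%:R * L <= n%:R ->
  M k.*2.+2 <= 5 * (k.*2.+1%:R * L / n%:R) * M k.*2.
Proof.
move=> kn; have odd_le : 2 * M k.*2.+1 <= M k.*2 + M k.*2.+2.
  rewrite -bmEZ// -bmED//; apply: bmE_le => [|//|x].
  - exact: bmfunZ.
  - exact: bmfunD.
  exact: mxtrace_odd_expr_le.
have q1 : k.*2.+1%:R * L / n%:R <= 1 by rewrite ler_pdivrMr ?mul1r// ltr0n.
have q0 : 0 <= k.*2.+1%:R * L / n%:R by rewrite divr_ge0// mulr_ge0.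
have := trace_moment_step k; have := trace_moment_ge0 k; move: odd_le q1 q0.
have := trace_moment_ge0 k.+1; rewrite doubleS.
set q := _ / _; nra.
Qed.

Lemma trace_moment_le p : p.*2%:R * L <= n%:R ->
  M p.*2 <= r%:R * (10 * p%:R * L / n%:R) ^+ p.
Proof.
move=> pn; suff H k : (k <= p)%N -> M k.*2 <= r%:R * (10 * p%:R * L / n%:R) ^+ k.
  exact: H.
elim: k => [|k IHk] kp.
  by rewrite /M; under eq_Rintegral do rewrite expr0 mxtrace1;
    rewrite bmE_cst mulr1.
(* Every step before p has 2k+1 <= 2p, so its contraction factor is at most 5 (2p) L / n, which is
   where the 10 comes from. *)
have kq : k.*2.+1%:R * L <= p.*2%:R * L.
  by rewrite ler_wpM2r// ler_nat; lia.
rewrite doubleS (le_trans (trace_moment_contract (le_trans kq pn)))//.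
have c0 : 0 <= 5 * (p.*2%:R * L / n%:R) by rewrite mulr_ge0// divr_ge0// mulr_ge0.
have -> : r%:R * (10 * p%:R * L / n%:R) ^+ k.+1 =
    5 * (p.*2%:R * L / n%:R) * (r%:R * (10 * p%:R * L / n%:R) ^+ k).
  by rewrite exprS -muln2 natrM; ring.
apply: ler_pM => //.
- by rewrite mulr_ge0// divr_ge0// mulr_ge0.
- exact: trace_moment_ge0.
- by rewrite ler_wpM2l// ler_wpM2r// invr_ge0.
- exact: IHk (ltnW kp).
Qed.

End trace_moments.

(** * Laws of tuples and construction of the spare sample *)

Section tuple_laws.
Context d (T : measurableType d) (R : realType) (n : nat).

Definition box (B : 'I_n -> set T) : set (n.-tuple T) :=
  [set x | forall j, B j (tnth x j)].

Lemma measurable_box B : (forall j, measurable (B j)) -> measurable (box B).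
Proof.
move=> mB.
rewrite (_ : box B = \bigcap_(j in [set: 'I_n]) ((@tnth _ T ^~ j) @^-1` B j)).
  apply: fin_bigcap_measurable => // j _; rewrite -[X in measurable X]setTI.
  exact: measurable_tnth.
by apply/seteqP; split=> x /= xB j => [_|]; exact: xB.
Qed.

(** Boxes are stable under intersection and generate the sigma-algebra of tuples: each generating
    cylinder is a box constrained in a single coordinate. *)
Lemma tuple_measure_unique (m1 m2 : {measure set (n.-tuple T) -> \bar R}) :
  (m1 setT < +oo)%E ->
  (forall B, (forall j, measurable (B j)) -> m1 (box B) = m2 (box B)) ->
  forall A, measurable A -> m1 A = m2 A.
Proof.
move=> m1oo m12 A mA.
pose G := [set box B | B in [set B : 'I_n -> set T | forall j, measurable (B j)]].
have GT : G setT.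
  exists (fun=> setT) => [j|]; first exact: measurableT.
  by apply/seteqP; split.
apply: (g_sigma_algebra_measure_unique G _ (fun=> setT)) => //.
- by move=> _ [B mB <-]; exact: measurable_box.
- by apply/seteqP; split=> // x _; exists 0%N.
- move=> _ _ [B mB <-] [B' mB' <-]; exists (fun j => B j `&` B' j) => [j|].
    exact: measurableI.
  apply/seteqP; split=> [x xB|x [xB xB'] j]; last by split.
  by split=> j; have [] := xB j.
- by move=> _ [B mB <-]; exact: m12.
have : measurable A by []; apply: smallest_sub; first exact: smallest_sigma_algebra.
move=> X; rewrite -bigcup_seq => -[i _ [B mB <-]].
apply: sub_sigma_algebra; exists (fun j => if j == i then B else setT).
  by move=> j; case: ifP.
rewrite setTI; apply/seteqP; split=> [x /(_ i)|x xB j].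
  by rewrite eqxx.
by case: eqP => // ->.
Qed.

End tuple_laws.

Section product_expectation.
Context d1 d2 (T1 : measurableType d1) (T2 : measurableType d2) (R : realType).
Variables (P1 : probability T1 R) (P2 : probability T2 R).

Lemma bmE_prod (f : T1 -> R) (h : T2 -> R) : bmfun f -> bmfun h ->
  \int[(P1 \x P2)%E]_q (f q.1 * h q.2) = \int[P1]_x f x * \int[P2]_y h y.
Proof.
move=> bf bh.
have bfh : bmfun (fun q : T1 * T2 => f q.1 * h q.2).
  by apply: bmfunM; [exact: (bmfun_comp measurable_fst bf)|
                     exact: (bmfun_comp measurable_snd bh)].
have ifh := bmfun_integrable (P1 \x P2)%E bfh.
rewrite {1}/Rintegral -(integral12_prod_meas1 ifh) -RintegralZr//; last first.
  exact: bmfun_integrable.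
congr fine; apply: eq_integral => x _; rewrite /fubini_F /=.
rewrite -RintegralZl//; last exact: bmfun_integrable.
rewrite /Rintegral fineK//; apply: integrable_fin_num => //.
by apply: bmfun_integrable; exact: bmfunZ.
Qed.

End product_expectation.

Section iid_sample.
Context dS (S : measurableType dS) d (T : measurableType d) (R : realType).
Variables (P : probability S R) (n : nat) (X : 'I_n -> {RV P >-> T}).
Variable (law : set T -> \bar R).
Hypothesis indep : mutually_independent P (fun i => X i).
Hypothesis sameX : forall i, has_law P (X i) law.
Variable i0 : 'I_n.

Definition sample (s : S) : n.-tuple T := [tuple X i s | i < n].

Lemma measurable_sample : measurable_fun [set: S] sample.
Proof.
apply/measurable_fun_tnthP => j.
rewrite (_ : _ \o _ = X j); first exact: measurable_funP.
by apply/funext => s; rewrite /= tnth_mktuple.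
Qed.

(** An independent copy is obtained from two copies of the probability space: the sample is read off
    the first coordinate, the spare entry is [X i0] read off the second. The index [i0] is arbitrary
    because all sensors share one law. *)
Let zeta (q : S * S) : n.+1.-tuple T := [tuple of X i0 q.2 :: sample q.1].

Let zeta0 q : tnth (zeta q) ord0 = X i0 q.2.
Proof. by []. Qed.

Let zetaS q i : tnth (zeta q) (lift ord0 i) = X i q.1.
Proof. by rewrite tnthS tnth_mktuple. Qed.

Let mzeta : measurable_fun [set: S * S] zeta.
Proof.
apply: measurable_cons.
  exact: (measurableT_comp (measurable_funP (X i0)) measurable_snd).
exact: (measurableT_comp measurable_sample measurable_fst).
Qed.

HB.instance Definition _ := isMeasurableFun.Build _ _ _ _ zeta mzeta.

Let rho : probability (n.+1.-tuple T) R := distribution (P \x P)%E zeta.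

Let rhoE (h : n.+1.-tuple T -> R) : bmfun h ->
  \int[rho]_x h x = \int[(P \x P)%E]_q h (zeta q).
Proof.
move=> bh; rewrite /Rintegral integral_distribution//.
  by apply/measurable_EFinP; case: bh.
by have := bmfun_integrable (P \x P)%E (bmfun_comp mzeta bh).
Qed.

Lemma spare_sample_fresh (f : T -> R) (h : n.-tuple T -> R) : bmfun f -> bmfun h ->
  \int[rho]_x (f (tnth x ord0) * h [tuple of behead x]) =
  \int[P]_s f (X i0 s) * \int[P]_s h (sample s).
Proof.
move=> bf bh; rewrite rhoE; last first.
  apply: bmfunM; last exact: (bmfun_comp (@measurable_behead _ T n) bh).
  by apply: (bmfun_comp _ bf); exact: measurable_tnth.
rewrite mulrC -bmE_prod; last 2 first.
- exact: (bmfun_comp measurable_sample bh).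
- exact: (bmfun_comp (measurable_funP (X i0)) bf).
apply: eq_Rintegral => -[s t] _ /=; rewrite mulrC; congr (h _ * _).
by apply: val_inj.
Qed.

Lemma spare_sample_head (f : T -> R) : bmfun f ->
  \int[rho]_x f (tnth x ord0) = \int[P]_s f (X i0 s).
Proof.
move=> bf; have := spare_sample_fresh bf (bmfun_cst _ 1).
rewrite /= bmE_cst mulr1 => <-.
by apply: eq_Rintegral => x _; rewrite mulr1.
Qed.

Lemma spare_sample_tail (h : n.-tuple T -> R) : bmfun h ->
  \int[rho]_x h [tuple of behead x] = \int[P]_s h (sample s).
Proof.
move=> bh; have := spare_sample_fresh (bmfun_cst _ 1) bh.
rewrite /= bmE_cst mul1r => <-.
by apply: eq_Rintegral => x _; rewrite mul1r.
Qed.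

Lemma spare_sample_box (B : 'I_n.+1 -> set T) : (forall j, measurable (B j)) ->
  rho (box B) = (\prod_j law (B j))%E.
Proof.
move=> mB.
rewrite /rho /distribution /pushforward /=.
have -> : zeta @^-1` box B = (\bigcap_(i in [set: 'I_n]) (X i @^-1` B (lift ord0 i)))
    `*` (X i0 @^-1` B ord0).
  apply/seteqP; split=> [q qB|q [/= sB tB] j].
    split=> [i _|]; last by have := qB ord0; rewrite zeta0.
    by have := qB (lift ord0 i); rewrite zetaS.
  have [->|] := eqVneq j ord0; first by rewrite zeta0.
  by rewrite eq_sym => /unlift_some[i -> _]; rewrite zetaS; exact: sB.
rewrite product_measure1E.
- transitivity ((\prod_(i < n) P (X i @^-1` B (lift ord0 i))) * law (B ord0))%E.
    congr (_ * _)%E; last exact: sameX.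
    exact: (indep (B := fun i => B (lift ord0 i))).
  rewrite big_ord_recl muleC; congr (_ * _)%E.
  by apply: eq_bigr => i _; exact: sameX.
- apply: fin_bigcap_measurable => // i _; rewrite -[X in measurable X]setTI.
  exact: measurable_funP.
- by rewrite -[X in measurable X]setTI; exact: measurable_funP.
Qed.

Let mresample i : measurable_fun [set: n.+1.-tuple T] (resample i).
Proof.
apply/measurable_fun_tnthP => j.
under [X in measurable_fun _ X]eq_fun do rewrite /= tnth_mktuple.
exact: measurable_tnth.
Qed.

HB.instance Definition _ i := isMeasurableFun.Build _ _ _ _ (resample i) (mresample i).

(** On boxes the law of the n+1 entries is a product of identical factors, hence insensitive to
    permuting the coordinates. Boxes determine the law. *)
Lemma spare_sample_exch i (h : n.+1.-tuple T -> R) : bmfun h ->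
  \int[rho]_x h (resample i x) = \int[rho]_x h x.
Proof.
move=> bh; rewrite /Rintegral; congr fine.
have -> : (\int[rho]_x (h (resample i x))%:E =
    \int[distribution rho (resample i)]_x (h x)%:E)%E.
  rewrite integral_distribution//.
    by apply/measurable_EFinP; case: bh.
  by have := bmfun_integrable rho (bmfun_comp (mresample i) bh).
apply: eq_measure_integral => A mA _.
apply: tuple_measure_unique mA => [|B mB].
  by rewrite (le_lt_trans (probability_le1 _ _))// ltry.
transitivity (rho (box (fun j => B (tperm ord0 (lift ord0 i) j)))).
  congr (rho _); apply/seteqP; split=> x xB j.
    by have := xB (tperm ord0 (lift ord0 i) j); rewrite tnth_mktuple tpermK.
  by have := xB (tperm ord0 (lift ord0 i) j); rewrite tpermK tnth_mktuple.
transitivity (\prod_j law (B j))%E; last exact: esym (spare_sample_box mB).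
rewrite spare_sample_box//.
by rewrite [RHS](reindex_inj (@perm_inj _ (tperm ord0 (lift ord0 i)))).
Qed.

Lemma gram_moment_le r (g : T -> 'cV[R]_r) (L : R) p :
  bmmx g -> (forall t, norm2 (g t) ^+ 2 <= L) ->
  (forall a b, \int[P]_s rank_one g (X i0 s) a b = (1%:M : 'M[R]_r) a b) ->
  p.*2%:R * L <= n%:R ->
  \int[P]_s \tr (gram_dev g (sample s) ^+ p.*2) <=
  r%:R * (10 * p%:R * L / n%:R) ^+ p.
Proof.
move=> bg gL iso pn.
have n0 : (0 < n)%N by case: n i0 => // -[].
rewrite -(@spare_sample_tail (fun x => \tr (gram_dev g x ^+ p.*2))); last first.
  by apply: bmfun_tr; apply: bmmxX; exact: bmmx_gram_dev.
apply: (trace_moment_le n0 bg gL) => //.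
- exact: spare_sample_exch.
- by move=> f h bf bh; rewrite spare_sample_fresh// spare_sample_head// spare_sample_tail.
- move=> a b; rewrite -iso.
  by apply: (@spare_sample_head (fun t => rank_one g t a b)); exact: bmmx_rank_one.
Qed.

End iid_sample.

(** * Tail bounds *)

Section opnorm2_measurable.
Context d (S : measurableType d) (R : realType).

(** The condition is an intersection, over uncountably many vectors v, of closed conditions on the
    entries. Closedness survives such intersections while measurability need not, so Borel
    measurability is deduced from it. Matrices are flattened to row vectors, which carry the Borel
    structure. *)
Lemma closed_opnorm2 m n (c : R) : 0 <= c ->
  closed [set w : 'rV[R]_(m * n) | opnorm2 (vec_mx w) <= c].
Proof.
move=> c0.
pose f (v : 'cV[R]_n) (w : 'rV[R]_(m * n)) := norm2 (vec_mx w *m v) ^+ 2.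
rewrite (_ : mkset _ = \bigcap_(v in [set: 'cV[R]_n])
    (f v @^-1` [set y | y <= c ^+ 2 * norm2 v ^+ 2])); last first.
  apply/seteqP; split=> w /=.
    by move=> /(opnorm2_leP _ c0) h v _; rewrite /= /f -ler_norm2P.
  by move=> h; apply/(opnorm2_leP _ c0) => v; rewrite ler_norm2P//; exact: h.
apply: closed_bigI => v _; apply: preimage_closed; last exact: closed_le.
suff cf : continuous (f v) by move=> w _; exact: cf.
have fE u : f v u = \sum_(i < m) (\sum_(j < n) u 0 (mxvec_index i j) * v j 0) ^+ 2.
  rewrite /f norm2_sqr mxE; apply: eq_bigr => i _; rewrite mxE -expr2.
  by congr (_ ^+ 2); rewrite mxE; apply: eq_bigr => j _; rewrite mxE.
have csum k (h : 'I_k -> 'rV[R]_(m * n) -> R) : (forall i, continuous (h i)) ->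
    continuous (fun u => \sum_(i < k) h i u).
  move=> ch; elim: k h ch => [|k IHk] h ch.
    rewrite (_ : (fun _ => _) = cst 0); first exact: cst_continuous.
    by apply/funext => u; rewrite big_ord0.
  rewrite (_ : (fun _ => _) = (fun u => h ord0 u + \sum_(i < k) h (lift ord0 i) u)).
    by move=> u; exact: (cvgD (ch ord0 u) (IHk _ (fun i => ch (lift ord0 i)) u)).
  by apply/funext => u; rewrite big_ord_recl.
have -> : f v = (fun u => \sum_(i < m)
    (\sum_(j < n) u 0 (mxvec_index i j) * v j 0) ^+ 2) by apply/funext.
apply: (csum _ (fun i u => (\sum_(j < n) u 0 (mxvec_index i j) * v j 0) ^+ 2)) => i.
have ci : continuous (fun u : 'rV[R]_(m * n) => \sum_(j < n) u 0 (mxvec_index i j) * v j 0).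
  apply: (csum _ (fun j u => u 0 (mxvec_index i j) * v j 0)) => j u.
  exact: (cvgM (@coord_continuous _ _ _ _ _ _) (cvg_cst _)).
by move=> u; exact: (cvgM (ci u) (ci u)).
Qed.

Lemma measurable_opnorm2_le m n (A : S -> 'M[R]_(m, n)) (c : R) : 0 <= c ->
  (forall i j, measurable_fun [set: S] (fun s => A s i j)) ->
  measurable [set s | opnorm2 (A s) <= c].
Proof.
move=> c0 mA.
have mv : measurable_fun [set: S] (fun s => mxvec (A s)).
  apply: measurable_fun_rV => k; case/mxvec_indexP: k => i j.
  by under eq_fun do rewrite mxvecE; exact: mA.
have -> : [set s | opnorm2 (A s) <= c] =
    (fun s => mxvec (A s)) @^-1` [set w | opnorm2 (vec_mx w) <= c].
  by apply/seteqP; split=> s /=; rewrite mxvecK.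
rewrite -[X in measurable X]setTI; apply: mv => //.
rewrite -[X in measurable X]setCK; apply: measurableC; apply: open_measurable_rV.
exact/closed_openC/closed_opnorm2.
Qed.

End opnorm2_measurable.

Section gram_tail.
Context dS (S : measurableType dS) d (T : measurableType d) (R : realType).
Variables (P : probability S R) (n : nat) (X : 'I_n -> {RV P >-> T}).
Variable (law : set T -> \bar R).
Hypothesis indep : mutually_independent P (fun i => X i).
Hypothesis sameX : forall i, has_law P (X i) law.
Variables (i0 : 'I_n) (r : nat) (g : T -> 'cV[R]_r) (L eta : R).
Hypothesis mg : forall a, measurable_fun [set: T] (fun t => g t a 0).
Hypothesis eta0 : 0 < eta.

Lemma measurable_gram_dev a b :
  measurable_fun [set: S] (fun s => gram_dev g (sample X s) a b).
Proof.
under eq_fun do rewrite !mxE summxE.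
apply: measurable_funB => //; apply: measurable_funM => //.
apply: measurable_sum => i.
rewrite (_ : (fun _ => _) = (fun t => g t a 0 * g t b 0) \o X i).
  by apply: measurableT_comp => //; apply: measurable_funM; exact: mg.
by apply/funext => s; rewrite /= tnth_mktuple !mxE big_ord1 !mxE.
Qed.

Lemma measurable_gram_dev_gt :
  measurable [set s | eta < opnorm2 (gram_dev g (sample X s))].
Proof.
rewrite (_ : mkset _ = ~` [set s | opnorm2 (gram_dev g (sample X s)) <= eta]).
  apply: measurableC; apply: measurable_opnorm2_le; first exact: ltW.
  exact: measurable_gram_dev.
by apply/seteqP; split=> s /=; rewrite ltNge => /negP.
Qed.

(** Markov's inequality for the moment of order 2p: on the bad event eta^(2p) is at most the trace
    of the 2p-th power of the deviation. *)
Lemma bounded_gram_tail p : bmmx g -> (forall t, norm2 (g t) ^+ 2 <= L) ->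
  (forall a b, \int[P]_s rank_one g (X i0 s) a b = (1%:M : 'M[R]_r) a b) ->
  (0 < p)%N -> p.*2%:R * L <= n%:R ->
  (P [set s | (eta < opnorm2 (gram_dev g (sample X s)))%R] <=
   (r%:R * (10 * p%:R * L / n%:R / eta ^+ 2) ^+ p)%:E)%E.
Proof.
move=> bg gL iso p0 pn; set A := [set s | _].
have mA : measurable A by exact: measurable_gram_dev_gt.
have bA : bmfun (\1_A : S -> R).
  split; first exact: measurable_indic.
  by exists 1 => s; rewrite indicE; case: (_ \in _); rewrite ?normr1 ?normr0.
have EA : P A = (\int[P]_s \1_A s)%:E.
  by rewrite /Rintegral integral_indic// setIT fineK// fin_num_measure.
have ep : 0 < eta ^+ p.*2 by rewrite exprn_gt0.
rewrite EA lee_fin exprMn exprVn -exprM mulnC muln2.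
rewrite mulrA ler_pdivlMr// mulrC -(bmEZ _ _ bA).
apply: le_trans (gram_moment_le indep sameX bg gL iso pn).
apply: bmE_le => [||s]; first exact: bmfunZ.
  apply: bmfun_tr; apply: bmmxX.
  exact: (bmmx_comp (@measurable_sample _ _ _ _ _ P n X) (bmmx_gram_dev bg n)).
have sW := trmx_gram_dev g (sample X s).
rewrite indicE; case: (boolP (s \in A)) => [/set_mem sA|_].
  rewrite mulr1; move: p0; case: p {pn ep} => // p _.
  exact: sym_opnorm2_trace.
rewrite mulr0; have := mxtrace_gram_expr 1%:M p sW.
by rewrite trmx1 mulmx1 mul1r.
Qed.

End gram_tail.

(** * Choice of the moment order and of the constant 120 *)

Section sample_size_bound.
Context (R : realType).

Lemma expRN1_ge : 4^-1 <= expR (- 1 : R).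
Proof.
have -> : (-1 : R) = - 2^-1 + - 2^-1 by field.
rewrite expRD; have := expR_ge1Dx (- 2^-1 : R) => h.
apply: (@le_trans _ _ (2^-1 * 2^-1)); first by rewrite -invfM -natrM.
have h2 : 2^-1 <= expR (- 2^-1 : R) by lra.
exact: ler_pM.
Qed.

Lemma ln2_ge : 2^-1 <= ln (2 : R).
Proof.
rewrite -ler_expR lnK ?posrE// -(invrK (expR _)) -expRN.
rewrite -[leRHS](invrK 2) lef_pV2 ?posrE ?expR_gt0//.
have := expR_ge1Dx (- 2^-1 : R); lra.
Qed.

(** With l the logarithm in the sample size and p = floor l + 1, one has l < p <= 3l because l >=
    1/2. The base of the power is then at most 30 L l / (n eta^2) <= 30/120 = 1/4 <= 1/e, so the
    power is at most e^(-l) = delta / (2 r (N+1)). Thus 120 = 10 * 3 * 4. *)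
Lemma sample_size_tail (r n N : nat) (L eta delta : R) :
  (0 < r)%N -> 1 <= L -> 0 < eta < 1 -> 0 < delta < 1 ->
  120 * L * eta ^- 2 * ln (2 * r%:R * N.+1%:R / delta) <= n%:R ->
  exists p, [/\ (0 < p)%N, p.*2%:R * L <= n%:R &
    r%:R * (10 * p%:R * L / n%:R / eta ^+ 2) ^+ p <= delta / (2 * N.+1%:R)].
Proof.
move=> r0 L1 /andP[e0 e1] /andP[d0 d1].
set x := 2 * _ * _ / _; set l := ln x => sz.
have r1 : 1 <= r%:R :> R by rewrite ler1n.
have N1 : 1 <= N.+1%:R :> R by rewrite ler1n.
(* Makes l at least ln 2 >= 1/2, so that rounding up costs only a factor 3. *)
have x2 : 2 <= x.
  rewrite ler_pdivlMr//; nra.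
have x0 : 0 < x by rewrite (lt_le_trans _ x2).
have l2 : 2^-1 <= l by rewrite (le_trans ln2_ge)// ler_ln ?posrE.
pose p := (Num.truncn l).+1.
have lp : l < p%:R by rewrite truncnS_gt.
have pl : p%:R <= 3 * l.
  have : (Num.truncn l)%:R <= l by rewrite truncn_le; lra.
  have -> : p%:R = (Num.truncn l)%:R + 1 :> R by rewrite natr1.
  lra.
have ee1 : 1 <= eta ^- 2 by rewrite invf_ge1 ?exprn_gt0// expr_le1// ltW.
have Ll : 2^-1 <= L * l by nra.
have sz1 : 120 * (L * l) <= n%:R.
  apply: le_trans sz.
  rewrite [leRHS](_ : _ = 120 * (L * l) * eta ^- 2); last by ring.
  by rewrite ler_peMr//; lra.
have n0 : 0 < n%:R :> R by lra.
have e20 : 0 < eta ^+ 2 by rewrite exprn_gt0.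
have sz2 : 120 * (L * l) <= n%:R * eta ^+ 2.
  rewrite -ler_pdivrMr// (le_trans _ sz)// le_eqVlt; apply/orP; left.
  by apply/eqP; ring.
exists p; split=> //.
  rewrite -muln2 natrM; nra.
have q4 : 10 * p%:R * L / n%:R / eta ^+ 2 <= 4^-1.
  rewrite -mulrA -invfM ler_pdivrMr ?mulr_gt0//; nra.
have q0 : 0 <= 10 * p%:R * L / n%:R / eta ^+ 2.
  by rewrite !divr_ge0 ?mulr_ge0 ?(ltW e20)//; lra.
have qe : (10 * p%:R * L / n%:R / eta ^+ 2) ^+ p <= expR (- l).
  apply: (@le_trans _ _ (expR (- 1) ^+ p)).
    by apply: lerXn2r; rewrite ?nnegrE ?expR_ge0// (le_trans q4 expRN1_ge).
  by rewrite -expRM_natl mulrN1 ler_expR lerN2 ltW.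
apply: le_trans (ler_wpM2l (ler0n R r) qe) _.
rewrite expRN lnK ?posrE// /x invf_div; rewrite le_eqVlt; apply/orP; left; apply/eqP.
have rN0 : r%:R != 0 :> R by rewrite gt_eqF ?ltr0n.
by rewrite mulrCA -[X in _ * (_ / (X * _))]mulrC -mulrA invfM mulVKf.
Qed.

End sample_size_bound.

Section essentially_bounded_tail.
Context dS (S : measurableType dS) d (T : measurableType d) (R : realType).
Variables (P : probability S R) (n : nat) (X : 'I_n -> {RV P >-> T}).
Variable (law : set T -> \bar R).
Hypothesis indep : mutually_independent P (fun i => X i).
Hypothesis sameX : forall i, has_law P (X i) law.
Variables (i0 : 'I_n) (r : nat) (psi : T -> 'cV[R]_r) (L eta : R).
Hypothesis mpsi : forall a, measurable_fun [set: T] (fun t => psi t a 0).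
Hypotheses (L0 : 0 <= L) (eta0 : 0 < eta).
Hypothesis psiL : forall i, {ae P, forall s, norm2 (psi (X i s)) ^+ 2 <= L}.
Hypothesis iso : forall a b,
  \int[P]_s rank_one psi (X i0 s) a b = (1%:M : 'M[R]_r) a b.

(** Truncation that turns the almost sure bound on [psi] into one valid at every point, as the
    moment argument demands. *)
Let g t : 'cV[R]_r := if norm2 (psi t) ^+ 2 <= L then psi t else 0.

Let mg a : measurable_fun [set: T] (fun t => g t a 0).
Proof.
rewrite (_ : (fun _ => _) = fun t => if norm2 (psi t) ^+ 2 <= L then psi t a 0 else 0).
  apply: measurable_fun_ifT => //; apply: measurable_fun_ler => //.
  rewrite (_ : (fun _ => _) = fun t => \sum_(i < r) psi t i 0 ^+ 2).
    by apply: measurable_sum => i; apply: measurable_funX; exact: mpsi.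
  apply/funext => t; rewrite norm2_sqr mxE.
  by apply: eq_bigr => i _; rewrite mxE expr2.
by apply/funext => t; rewrite /g; case: ifP => //; rewrite mxE.
Qed.

Let gL t : norm2 (g t) ^+ 2 <= L.
Proof. by rewrite /g; case: ifP => // _; rewrite norm2_0 expr0n. Qed.

Let bg : bmmx g.
Proof.
move=> a j; rewrite ord1; split; first exact: mg.
exists (1 + L) => t; have := gL t; rewrite norm2_sqr mxE (bigD1 a)//= mxE.
set x := g t a 0; set y := \sum_(_ | _) _.
have : 0 <= y by apply: sumr_ge0 => i _; rewrite mxE -expr2 sqr_ge0.
move=> y0 xL; have : `|x| ^+ 2 <= L by rewrite real_normK ?num_real//; nra.
have := normr_ge0 x; nra.
Qed.

Let gpsi : {ae P, forall s, forall i, g (X i s) = psi (X i s)}.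
Proof.
apply: (@filter_forall _ _ (fun i s => g (X i s) = psi (X i s))) => i.
by apply: filterS (psiL i) => s; rewrite /g => ->.
Qed.

Lemma gram_tail p : (0 < p)%N -> p.*2%:R * L <= n%:R ->
  (P [set s | (eta < opnorm2 (gram_dev psi (sample X s)))%R] <=
   (r%:R * (10 * p%:R * L / n%:R / eta ^+ 2) ^+ p)%:E)%E.
Proof.
move=> p0 pn; have giso a b : \int[P]_s rank_one g (X i0 s) a b = (1%:M : 'M[R]_r) a b.
  rewrite -iso /Rintegral; congr fine; apply: ae_eq_integral => //.
  - apply/measurable_EFinP; have [m _] := bmmx_rank_one bg a b.
    exact: (measurableT_comp m (measurable_funP (X i0))).
  - apply/measurable_EFinP.
    under eq_fun do rewrite mxE big_ord1 mxE.
    apply: measurable_funM; apply: (measurableT_comp (mpsi _) (measurable_funP (X i0))).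
  - by apply: filterS gpsi => s /(_ i0) h _; rewrite /rank_one h.
have tail := bounded_gram_tail indep sameX mg eta0 bg gL giso p0 pn.
have [N [mN N0 gN]] := gpsi.
pose A (f : T -> 'cV[R]_r) := [set s | (eta < opnorm2 (gram_dev f (sample X s)))%R].
have mA : measurable (A psi) := measurable_gram_dev_gt X mpsi eta0.
have mB : measurable (A g) := measurable_gram_dev_gt X mg eta0.
(* Outside a single null set, common to the finitely many sensors, truncated and true features give
   the same Gram matrix. *)
have AB : A psi `<=` A g `|` N.
  move=> s As; have [sN|sN] := pselect (N s); [by right|left].
  have gs : forall i, g (X i s) = psi (X i s).
    by apply: contrapT => h; apply: sN; exact: gN.
  suff gE : gram_dev g (sample X s) = gram_dev psi (sample X s).
    by move: As; rewrite /A /= gE.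
  rewrite /gram_dev; congr (_ *: _ - _); apply: eq_bigr => i _.
  by rewrite tnth_mktuple /rank_one gs.
have le1 : (P (A psi) <= P (A g `|` N))%E.
  exact: (le_measure P (mem_set mA) (mem_set (measurableU _ _ mB mN)) AB).
apply: le_trans le1 _; apply: le_trans (measureU2 _ mB mN) _.
rewrite -[leRHS]adde0; apply: leeD; first exact: tail.
by rewrite -N0.
Qed.

End essentially_bounded_tail.

(** * Whitened features and the Gram event *)

Section integrable_sums.
Context d (T : measurableType d) (R : realType) (mu : {measure set T -> \bar R}).

Lemma integrable_EFin_sum (I : Type) (s : seq I) (h : I -> T -> R) :
  (forall i, mu.-integrable setT (EFin \o h i)) ->
  mu.-integrable setT (EFin \o (fun x => \sum_(i <- s) h i x)).
Proof.
move=> ih; rewrite (_ : _ \o _ = fun x => (\sum_(i <- s) (h i x)%:E)%E).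
  by apply: integrable_sum => // i _; exact: ih.
by apply/funext => x /=; rewrite sumEFin.
Qed.

Lemma integrable_EFinZ (c : R) (h : T -> R) : mu.-integrable setT (EFin \o h) ->
  mu.-integrable setT (EFin \o (fun x => c * h x)).
Proof.
move=> ih; rewrite (_ : _ \o _ = (fun x => c%:E * (EFin \o h) x)%E).
  exact: integrableZl.
by apply/funext => x; rewrite /= EFinM.
Qed.

Lemma Rintegral_sum (I : Type) (s : seq I) (h : I -> T -> R) :
  (forall i, mu.-integrable setT (EFin \o h i)) ->
  \int[mu]_x (\sum_(i <- s) h i x) = \sum_(i <- s) \int[mu]_x h i x.
Proof.
move=> ih; elim: s => [|i s IHs].
  under [LHS]eq_Rintegral do rewrite big_nil.
  by rewrite big_nil Rintegral_cst// mul0r.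
under [LHS]eq_Rintegral do rewrite big_cons.
by rewrite big_cons RintegralD ?IHs//; exact: integrable_EFin_sum.
Qed.

Lemma in_L2_mul_integrable (f g : T -> R) : in_L2 mu f -> in_L2 mu g ->
  mu.-integrable setT (EFin \o (fun x => f x * g x)).
Proof.
move=> [mf fL] [mg gL]; apply/Lfun1_integrable; apply: Lfun2_mul_Lfun1.
  by rewrite inE; apply/andP; split; rewrite inE.
by rewrite inE; apply/andP; split; rewrite inE.
Qed.

Lemma sqr_L2norm (f : T -> R) :
  (L2norm mu f ^+ 2 = \int[mu]_x (f x ^+ 2)%:E)%E.
Proof.
have sqE (x : \bar R) : (0 <= x -> x ^+ 2 = x `^ 2)%E.
  case: x => [x| |]// x0; first by rewrite poweR_EFin powR_mulrn.
  by rewrite poweRyr// mulyy.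
rewrite sqE ?Lnorm_ge0// /L2norm poweR_Lnorm//.
apply: eq_integral => x _ /=.
by rewrite powR_mulrn// real_normK// num_real.
Qed.

End integrable_sums.

Section law_transfer.
Context dS (S : measurableType dS) d (T : measurableType d) (R : realType).
Variables (P : probability S R) (X : {RV P >-> T}) (mu : {measure set T -> \bar R}).
Hypothesis lawX : has_law P X mu.

Lemma ae_has_law (Q : T -> Prop) : {ae mu, forall t, Q t} -> {ae P, forall s, Q (X s)}.
Proof.
move=> [N [mN N0 QN]]; exists (X @^-1` N); split.
- by rewrite -[X in measurable X]setTI; exact: measurable_funP.
- by rewrite lawX.
- by move=> s /= h; apply: QN.
Qed.

Lemma Rintegral_has_law (f : T -> R) : mu.-integrable setT (EFin \o f) ->
  \int[P]_s f (X s) = \int[mu]_t f t.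
Proof.
move=> /integrableP[mf foo].
have mfX : measurable_fun setT (EFin \o (f \o X)).
  exact: (measurableT_comp mf (measurable_funP X)).
rewrite /Rintegral; congr fine.
transitivity (\int[distribution P X]_t (f t)%:E)%E.
  rewrite integral_distribution//; apply/integrableP; split=> //.
  rewrite (le_lt_trans _ foo)// -(ge0_integral_distribution X (f := fun t => `|(f t)%:E|%E))//.
    rewrite le_eqVlt; apply/orP; left; apply/eqP.
    by apply: eq_measure_integral => A mA _; exact: lawX.
  exact: (measurableT_comp _ mf).
by apply: eq_measure_integral => A mA _; exact: lawX.
Qed.

End law_transfer.

Section whitened_features.
Context d (T : measurableType d) (R : realType) (mu : {measure set T -> \bar R}).
Variables (m : nat) (tau : R) (fs : feature_space mu m tau).
Hypothesis tau0 : 0 <= tau.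

Lemma measurable_Psi a : measurable_fun [set: T] (fun t => Psi fs t a 0).
Proof.
under eq_fun do rewrite mxE; apply: measurable_sum => j.
under eq_fun do rewrite mxE; apply: measurable_funM => //.
by under eq_fun do rewrite mxE; have [] := feature_L2 fs j.
Qed.

Lemma whitening_mass_matrix :
  (whitening fs)^T *m mass_matrix mu (feature fs) *m whitening fs = 1%:M.
Proof.
have [VV -> _ lam0] := eigenP fs.
set V := eigvecs fs in VV *; set lam := eigvals fs in lam0 *.
pose f := @enum_val _ (mem (retained lam tau)).
(* Selects the retained columns and scales them, so that V^T V = I reduces the product to a diagonal
   computation. *)
pose Y : 'M[R]_(m.+1, eff_rank fs) :=
  \matrix_(i, a) ((i == f a)%:R * (Num.sqrt (lam 0 (f a)))^-1).
have -> : whitening fs = V *m Y.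
  rewrite /whitening -[X in colsub _ X]mulmx1 -mulmx_colsub -mulmxA.
  congr (_ *m _); apply/matrixP => i a; rewrite mul_mx_diag !mxE.
  by [].
have -> : (V *m Y)^T *m (V *m diag_mx lam *m V^T) *m (V *m Y) =
    Y^T *m diag_mx lam *m Y.
  rewrite trmx_mul -!mulmxA (mulmxA V^T V) VV mul1mx.
  by rewrite (mulmxA V^T V) VV mul1mx.
apply/matrixP => a b; rewrite mxE (bigD1 (f b))//= big1 => [|i ib]; last first.
  by rewrite [Y _ _]mxE (negbTE ib) mul0r mulr0.
rewrite mul_mx_diag !mxE eqxx mul1r addr0 (inj_eq enum_val_inj).
have [->|ab] := eqVneq a b; last by rewrite !(mul0r, mulr0).
rewrite mul1r mulrAC -invfM -expr2 sqr_sqrtr ?mulVf//.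
(* Retained eigenvalues exceed tau times the largest one, which is nonnegative, so they are positive
   and can be inverted. *)
have : f b \in retained lam tau by exact: enum_valP.
rewrite inE => lb; rewrite gt_eqF// (le_lt_trans _ lb)// mulr_ge0//.
Qed.

Lemma Psi_mul_integrable a b :
  mu.-integrable setT (EFin \o (fun t => Psi fs t a 0 * Psi fs t b 0)).
Proof.
rewrite (_ : (fun _ => _) = fun t => \sum_j \sum_k
    (whitening fs j a * whitening fs k b) * (feature fs j t * feature fs k t)).
  apply: integrable_EFin_sum => j; apply: integrable_EFin_sum => k.
  by apply: integrable_EFinZ; apply: in_L2_mul_integrable; exact: feature_L2.
apply/funext => t; rewrite !mxE big_distrlr /=.
apply: eq_bigr => j _; apply: eq_bigr => k _; rewrite !mxE; ring.
Qed.

Lemma Psi_orthonormal a b :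
  \int[mu]_t (Psi fs t a 0 * Psi fs t b 0) = (1%:M : 'M[R]_(eff_rank fs)) a b.
Proof.
rewrite -whitening_mass_matrix.
transitivity (\int[mu]_t \sum_k \sum_j
    (whitening fs j a * whitening fs k b) * (feature fs j t * feature fs k t)).
  apply: eq_Rintegral => t _; rewrite !mxE big_distrlr exchange_big /=.
  apply: eq_bigr => j _; apply: eq_bigr => k _; rewrite !mxE; ring.
have int j k c : mu.-integrable setT (EFin \o (fun t => c * (feature fs j t * feature fs k t))).
  by apply: integrable_EFinZ; apply: in_L2_mul_integrable; exact: feature_L2.
rewrite Rintegral_sum => [|k]; last by apply: integrable_EFin_sum => j.
rewrite mxE; apply: eq_bigr => k _; rewrite Rintegral_sum//.
rewrite [X in _ = X * _]mxE mulr_suml; apply: eq_bigr => j _.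
rewrite RintegralZl//; last by apply: in_L2_mul_integrable; exact: feature_L2.
by rewrite [_^T _ _]mxE [mass_matrix _ _ _ _]mxE; ring.
Qed.

(** Orthonormality makes synthesis an isometry from coefficients to L^2, so errors of functions can
    be measured on coefficients. *)
Lemma Rintegral_sqr_synthesis (z : 'cV[R]_(eff_rank fs)) :
  mu.-integrable setT (EFin \o (fun t => synthesis z t ^+ 2)) /\
  \int[mu]_t (synthesis z t ^+ 2) = norm2 z ^+ 2.
Proof.
have E t : synthesis z t ^+ 2 =
    \sum_a \sum_b (z a 0 * z b 0) * (Psi fs t a 0 * Psi fs t b 0).
  rewrite expr2 /synthesis !mxE big_distrlr /=.
  apply: eq_bigr => a _; apply: eq_bigr => b _; rewrite !mxE; ring.
have iab a b : mu.-integrable setT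
    (EFin \o (fun t => (z a 0 * z b 0) * (Psi fs t a 0 * Psi fs t b 0))).
  by apply: integrable_EFinZ; exact: Psi_mul_integrable.
have ia a : mu.-integrable setT
    (EFin \o (fun t => \sum_b (z a 0 * z b 0) * (Psi fs t a 0 * Psi fs t b 0))).
  exact: integrable_EFin_sum.
split; first by under [X in _ \o X]eq_fun do rewrite E; exact: integrable_EFin_sum.
under eq_Rintegral do rewrite E.
rewrite Rintegral_sum// norm2_sqr mxE; apply: eq_bigr => a _.
rewrite Rintegral_sum// (bigD1 a)//= big1 ?addr0 => [|b ba].
  rewrite RintegralZl//; last exact: Psi_mul_integrable.
  by rewrite Psi_orthonormal !mxE eqxx mulr1.
rewrite RintegralZl//; last exact: Psi_mul_integrable.
by rewrite Psi_orthonormal mxE eq_sym (negbTE ba) mulr0.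
Qed.

Lemma sensor_gram No (x : 'I_No -> T) :
  (sensor_matrix fs x)^T *m sensor_matrix fs x = \sum_i rank_one (Psi fs) (x i).
Proof.
apply/matrixP => a b; rewrite mxE summxE; apply: eq_bigr => i _.
by rewrite !mxE big_ord1 !mxE.
Qed.

End whitened_features.

Section gram_event_probability.
Context dS (S : measurableType dS) d (T : measurableType d) (R : realType).
Variables (P : probability S R) (mu : {measure set T -> \bar R}).
Variables (N No : nat) (X : nat -> 'I_No -> {RV P >-> T}).
Hypothesis indep : mutually_independent P (fun k : 'I_N.+1 * 'I_No => X k.1 k.2).
Hypothesis lawX : forall n i, (n <= N)%N -> has_law P (X n i) mu.

(** The sets at all other times are taken to be the full space, whose factors are 1. *)
Lemma mutually_independent_slice n : (n <= N)%N ->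
  mutually_independent P (fun i => X n i).
Proof.
move=> nN B mB; pose n' : 'I_N.+1 := inord n.
have n'E : nat_of_ord n' = n by rewrite inordK.
have := indep (B := fun k => if k.1 == n' then B k.2 else setT).
have mB' (k : 'I_N.+1 * 'I_No) : measurable (if k.1 == n' then B k.2 else setT).
  by case: ifP.
move=> /(_ mB').
have -> : \bigcap_(k in [set: 'I_N.+1 * 'I_No])
    (X k.1 k.2 @^-1` (if k.1 == n' then B k.2 else setT)) =
    \bigcap_(i in [set: 'I_No]) (X n i @^-1` B i).
  apply/seteqP; split=> s /= sB.
    by move=> i _; have := sB (n', i) I; rewrite /= eqxx n'E.
  move=> [k i] _ /=; case: eqP => // -> /=; rewrite n'E; exact: sB.
move=> ->; rewrite -(pair_bigA _ (fun (k : 'I_N.+1) (i : 'I_No) =>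
  P (X k i @^-1` (if k == n' then B i else setT)))) /=.
rewrite (bigD1 n')//= [X in (_ * X)%E]big1 ?mule1 => [|k kn]; last first.
  by rewrite big1// => i _; rewrite (negbTE kn) preimage_setT probability_setT.
by apply: eq_bigr => i _; rewrite eqxx n'E.
Qed.

Variables (m : nat) (tau : R) (fs : feature_space mu m tau) (Lstar eta delta : R).
Hypotheses (tau0 : 0 <= tau) (eta01 : 0 < eta < 1) (delta01 : 0 < delta < 1).
Hypotheses (lev : (leverage fs <= Lstar%:E)%E) (rL : (eff_rank fs)%:R <= Lstar).
Hypothesis size_ok : sample_size fs 120 Lstar eta delta N <= No%:R.

Let eta0 : 0 < eta. Proof. by case/andP: eta01. Qed.

Let r0 : (0 < eff_rank fs)%N. Proof. exact: retained_gt0. Qed.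

Let L1 : 1 <= Lstar.
Proof. by rewrite (le_trans _ rL)// ler1n. Qed.

Lemma sample_size_gt0 : (0 < No)%N.
Proof.
have [p [p0 pn _]] := sample_size_tail r0 L1 eta01 delta01 size_ok.
rewrite -(ltr0n R) (lt_le_trans _ pn)// mulr_gt0 ?ltr0n ?double_gt0//.
exact: lt_le_trans L1.
Qed.

Lemma sensor_gram_dev n s :
  No%:R^-1 *: ((sensor_matrix fs (X n ^~ s))^T *m sensor_matrix fs (X n ^~ s)) - 1%:M =
  gram_dev (Psi fs) (sample (X n) s).
Proof.
rewrite sensor_gram /gram_dev; congr (_ *: _ - _).
by apply: eq_bigr => i _; rewrite tnth_mktuple.
Qed.

Lemma gram_event_probability :
  ((1 - delta)%:E <= P [set s | gram_event fs N eta (fun n i => X n i s)])%E.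
Proof.
have [p [p0 pn tail]] := sample_size_tail r0 L1 eta01 delta01 size_ok.
pose bad n := [set s | eta < opnorm2 (gram_dev (Psi fs) (sample (X n) s))].
have mbad n : measurable (bad n).
  exact: (measurable_gram_dev_gt (X n) (measurable_Psi (fs := fs)) eta0).
have badP n : (n < N.+1)%N -> (P (bad n) <= (delta / (2 * N.+1%:R))%:E)%E.
  rewrite ltnS => nN; have i0 : 'I_No := Ordinal sample_size_gt0.
  apply: (le_trans _ (y := (_)%:E)); last by rewrite lee_fin; exact: tail.
  apply: (gram_tail (mutually_independent_slice nN) (fun i => lawX i nN)
    (i0 := i0) (measurable_Psi (fs := fs)) (le_trans ler01 L1) eta0) => //.
  - move=> i; apply: (ae_has_law (lawX i nN) (Q := fun t => norm2 (Psi fs t) ^+ 2 <= Lstar)).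
    by have /ess_supP := lev; apply: filterS => t; rewrite lee_fin.
  - move=> a b; rewrite -(Psi_orthonormal tau0).
    under eq_Rintegral do rewrite rank_oneE.
    exact: (Rintegral_has_law (lawX i0 nN) (Psi_mul_integrable (fs := fs) a b)).
have -> : [set s | gram_event fs N eta (fun n i => X n i s)] =
    ~` \big[setU/set0]_(n < N.+1) bad n.
  apply/seteqP; split=> s /= sg.
    rewrite -bigcup_mkord => -[n /= nN]; rewrite /bad /= ltNge => /negP; apply.
    by rewrite -sensor_gram_dev; exact: sg.
  move=> n nN /=; rewrite sensor_gram_dev leNgt; apply/negP => sn; apply: sg.
  by rewrite -bigcup_mkord; exists n.
have mU : measurable (\big[setU/set0]_(n < N.+1) bad n) by exact: bigsetU_measurable.
rewrite probability_setC// EFinB leeB//.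
(* Union bound over the N+1 analysis times, each failing with probability at most delta / (2
   (N+1)). *)
apply: (@le_trans _ _ (\sum_(n < N.+1) P (bad n))%E).
  by apply: (@content_subadditive _ _ _ P _ bad N.+1).
apply: (@le_trans _ _ (\sum_(n < N.+1) (delta / (2 * N.+1%:R))%:E)%E).
  by apply: lee_sum => n _; exact: badP.
rewrite sumEFin lee_fin sumr_const card_ord -mulr_natr.
have N0 : 0 < N.+1%:R :> R by rewrite ltr0n.
have [d0 _] := andP delta01.
rewrite [leLHS](_ : _ = delta / 2); last by field; rewrite gt_eqF.
lra.
Qed.

End gram_event_probability.

(** * Gaussian noise *)

Section density.
Import HBNNSimple.
Local Open Scope ereal_scope.
Context d (T : measurableType d) (R : realType).
Variables (mu nu : {measure set T -> \bar R}) (p : T -> R).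
Hypotheses (mp : measurable_fun [set: T] p) (p0 : forall x, (0 <= p x)%R).
Hypothesis nuE : forall A, measurable A -> nu A = \int[mu]_(x in A) (p x)%:E.

(** A simple function g below f has a nu-integral equal to the mu-integral of g p, which is at most
    that of f p. The supremum over g gives the claim. *)
Lemma ge0_integral_density_le (f : T -> R) :
  measurable_fun [set: T] f -> (forall x, (0 <= f x)%R) ->
  \int[nu]_x (f x)%:E <= \int[mu]_x (f x * p x)%:E.
Proof.
move=> mf f0; rewrite ge0_integralTE => [|x]; last by rewrite lee_fin.
apply: ge_ereal_sup => _ [g /= gf <-].
apply: (@le_trans _ _ (\int[mu]_x (g x * p x)%:E)); last first.
  apply: ge0_le_integral => //.
  - by move=> x _; rewrite lee_fin mulr_ge0.
  - by apply/measurable_EFinP; exact: measurable_funM.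
  - by apply/measurable_EFinP; exact: measurable_funM.
  - by move=> x _; rewrite lee_fin ler_wpM2r//; have := gf x; rewrite lee_fin.
have mI y : measurable_fun [set: T] (fun x => y * \1_(g @^-1` [set y]) x * p x)%R.
  by apply: measurable_funM => //; apply: measurable_funM.
have yI0 y x : (0 <= y * \1_(g @^-1` [set y]) x * p x)%R.
  rewrite mulr_ge0//; have := nnfun_muleindic_ge0 g y x.
  by rewrite -EFinM lee_fin.
rewrite sintegralE.
under [leRHS]eq_integral => x _.
  rewrite fimfunE fsbig_finite//= mulr_suml -sumEFin -fsbig_finite//=; over.
rewrite ge0_integral_fsum//; last 2 first.
  by move=> y; apply/measurable_EFinP; exact: mI.
  by move=> y x _; rewrite lee_fin.
rewrite le_eqVlt; apply/orP; left; apply/eqP; apply: eq_fsbigr => y /[!inE] -[t _ <-].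
have mA : measurable (g @^-1` [set g t]) by [].
rewrite nuE// integral_mkcond -ge0_integralZl//; last 3 first.
- by apply/(measurable_restrictT _ _).1 => //; apply: measurable_funTS; exact/measurable_EFinP.
- by move=> x _; apply: erestrict_ge0 => z _; rewrite lee_fin.
- by rewrite lee_fin.
apply: eq_integral => x _; rewrite patchE indicE.
by case: ifP => _; rewrite ?mulr1 ?mulr0 ?mul0r ?mule0 ?EFinM.
Qed.

End density.

Section normal_moments.
Context (R : realType) (sigma : R).
Hypothesis s0 : 0 < sigma.

Let pdfE (s x : R) : s != 0 ->
  normal_pdf 0 s x = normal_peak s * expR (- x ^+ 2 / (s ^+ 2 *+ 2)).
Proof. by move=> sN0; rewrite normal_pdfE// /normal_fun subr0. Qed.

(** Dominating by a Gaussian of doubled deviation replaces the computation of the variance. With y =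
    x^2 / (8 sigma^2) the exponent -4y splits into -y, which is that of the wider Gaussian, and -3y,
    which absorbs y since y e^(-3y) <= 1. The constant is 16 = 8 * 2, the 2 being the ratio of the
    peaks. *)
Lemma sqr_normal_pdf_le x :
  x ^+ 2 * normal_pdf 0 sigma x <= 16 * sigma ^+ 2 * normal_pdf 0 (2 * sigma) x.
Proof.
rewrite !pdfE ?gt_eqF ?mulr_gt0//.
have -> : normal_peak sigma = 2 * normal_peak (2 * sigma).
  rewrite /normal_peak.
  have -> : (2 * sigma) ^+ 2 * pi *+ 2 = 2 ^+ 2 * (sigma ^+ 2 * pi *+ 2) by ring.
  rewrite (sqrtrM _ (sqr_ge0 _)).
  by rewrite sqrtr_sqr ger0_norm// invfM mulVKf.
have sN0 : sigma != 0 by rewrite gt_eqF.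
set y := x ^+ 2 / (8 * sigma ^+ 2).
have y0 : 0 <= y by rewrite divr_ge0 ?sqr_ge0// mulr_ge0 ?sqr_ge0.
have -> : - x ^+ 2 / (sigma ^+ 2 *+ 2) = - y + - (3 * y) by rewrite /y; field.
have -> : - x ^+ 2 / ((2 * sigma) ^+ 2 *+ 2) = - y by rewrite /y; field.
have x2 : x ^+ 2 = 8 * sigma ^+ 2 * y by rewrite /y; field.
rewrite expRD x2.
have h : y * expR (- (3 * y)) <= 1.
  rewrite expRN ler_pdivrMr ?expR_gt0// mul1r.
  by have := expR_ge1Dx (3 * y); lra.
have e0 := expR_ge0 (- y); have p0 := normal_peak_ge0 (2 * sigma).
have c0 : 0 <= 16 * sigma ^+ 2 * (normal_peak (2 * sigma) * expR (- y)).
  by rewrite !mulr_ge0// ltW.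
rewrite [leLHS](_ : _ = 16 * sigma ^+ 2 * (normal_peak (2 * sigma) * expR (- y)) *
  (y * expR (- (3 * y)))); last by ring.
by rewrite ler_piMr.
Qed.

Lemma normal_second_moment_le :
  (\int[normal_prob 0 sigma]_x (x ^+ 2)%:E <= (16 * sigma ^+ 2)%:E)%E.
Proof.
have := @ge0_integral_density_le _ _ R lebesgue_measure (normal_prob 0 sigma)
  (normal_pdf 0 sigma) (measurable_normal_pdf _ _) (normal_pdf_ge0 _ _)
  (fun _ _ => erefl) (fun x => x ^+ 2).
move=> /(_ _ (fun x => sqr_ge0 x)) h; apply: le_trans (h _) _.
  exact: measurable_funX.
apply: (@le_trans _ _ (\int[lebesgue_measure]_x
    ((16 * sigma ^+ 2)%:E * (normal_pdf 0 (2 * sigma) x)%:E))%E).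
  apply: ge0_le_integral => //.
  - by move=> x _; rewrite lee_fin mulr_ge0 ?sqr_ge0 ?normal_pdf_ge0.
  - apply/measurable_EFinP; apply: measurable_funM; first exact: measurable_funX.
    exact: measurable_normal_pdf.
  - by apply: measurable_funeM; apply/measurable_EFinP; exact: measurable_normal_pdf.
  - by move=> x _; rewrite -EFinM lee_fin; exact: sqr_normal_pdf_le.
rewrite ge0_integralZl//.
- by rewrite integral_normal_pdf mule1.
- by apply/measurable_EFinP; exact: measurable_normal_pdf.
- by move=> x _; rewrite lee_fin normal_pdf_ge0.
- by rewrite lee_fin mulr_ge0// sqr_ge0.
Qed.

Lemma normal_prob_opp (A : set R) : measurable A ->
  normal_prob 0 sigma (-%R @^-1` A) = normal_prob 0 sigma A.
Proof.
move=> mA; rewrite /normal_prob.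
have mpdf : measurable_fun A (fun x => (normal_pdf 0 sigma x)%:E).
  by apply: measurable_funTS; apply/measurable_EFinP; exact: measurable_normal_pdf.
transitivity (\int[pushforward lebesgue_measure (-%R : R -> measurableTypeR R)]_(x in A)
   (normal_pdf 0 sigma x)%:E)%E.
  rewrite ge0_integral_pushforward//.
    apply: eq_integral => x _ /=; rewrite !pdfE ?gt_eqF//.
    by rewrite sqrrN.
  by move=> x _; rewrite lee_fin normal_pdf_ge0.
by apply: eq_measure_integral => B mB _; exact: lebesgue_measureN.
Qed.

End normal_moments.

Section normal_variable.
Context dW (W : measurableType dW) (R : realType) (P : probability W R).
Variables (X : {RV P >-> R}) (sigma : R).
Hypotheses (s0 : 0 < sigma) (lawX : has_law P X (normal_prob 0 sigma)).

(* The target of X carries the default display, the domain of integrals against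
   [normal_prob] that of [measurableTypeR]. *)
Let mXR : measurable_fun [set: W] (X : W -> measurableTypeR R).
Proof. exact: (measurable_funP X). Qed.

Let XR : {RV P >-> measurableTypeR R} :=
  HB.pack (X : W -> measurableTypeR R) (isMeasurableFun.Build _ _ _ _ _ mXR).

Lemma normal_variable_sqr :
  P.-integrable setT (EFin \o (fun w => X w ^+ 2)) /\
  \int[P]_w (X w ^+ 2) <= 16 * sigma ^+ 2.
Proof.
have mX2 : measurable_fun [set: W] (fun w => X w ^+ 2) by exact: measurable_funX.
have le16 : (\int[P]_w (X w ^+ 2)%:E <= (16 * sigma ^+ 2)%:E)%E.
  apply: le_trans (normal_second_moment_le s0).
  rewrite -(ge0_integral_distribution XR (f := fun x => (x ^+ 2)%:E))//.
  - rewrite le_eqVlt; apply/orP; left; apply/eqP.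
    by apply: eq_measure_integral => A mA _; exact: lawX.
  - by apply/measurable_EFinP; exact: measurable_funX.
  - by move=> x; rewrite lee_fin sqr_ge0.
split.
  apply/integrableP; split; first exact/measurable_EFinP.
  rewrite (le_lt_trans _ (ltry (16 * sigma ^+ 2)))//.
  apply: le_trans le16; under eq_integral do rewrite /= ger0_norm ?sqr_ge0//.
  by [].
rewrite -lee_fin /Rintegral fineK// ge0_fin_numE.
  by rewrite (le_lt_trans le16)// ltry.
by apply: integral_ge0 => w _; rewrite lee_fin sqr_ge0.
Qed.

Lemma normal_variable_integrable : P.-integrable setT (EFin \o X).
Proof.
have [iX2 _] := normal_variable_sqr.
have i1 : P.-integrable setT (EFin \o (fun w => 1 + X w ^+ 2)).
  have ic : P.-integrable setT (EFin \o (fun _ : W => 1 : R)).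
    exact: (bmfun_integrable P (bmfun_cst _ 1)).
  by have := integrableD measurableT ic iX2.
apply: le_integrable i1 => //; first exact/measurable_EFinP.
move=> w _; rewrite /= lee_fin [leRHS]ger0_norm; last by rewrite addr_ge0 ?sqr_ge0.
have := normr_ge0 (X w); have : `|X w| ^+ 2 = X w ^+ 2 by rewrite real_normK ?num_real.
nra.
Qed.

(** X and -X have the same law, so the mean equals its own opposite. *)
Lemma normal_variable_mean : \int[P]_w X w = 0.
Proof.
have iX := normal_variable_integrable.
pose X' : W -> measurableTypeR R := fun w => - X w.
have mX' : measurable_fun [set: W] X' by exact: (measurable_funN (measurable_funP X)).
pose XN : {RV P >-> measurableTypeR R} :=
  HB.pack X' (isMeasurableFun.Build _ _ _ _ X' mX').
have EX : \int[P]_w X w = \int[distribution P XR]_x x.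
  by rewrite /Rintegral (integral_distribution (X := XR) (f := EFin)).
have EXN : \int[P]_w X' w = \int[distribution P XN]_x x.
  rewrite /Rintegral (integral_distribution (X := XN) (f := EFin))//.
  by have := integrableN iX.
have : \int[P]_w X w = \int[P]_w X' w.
  rewrite EX EXN /Rintegral; congr fine; apply: eq_measure_integral => A mA _.
  transitivity (normal_prob 0 sigma A); first exact: lawX.
  rewrite -normal_prob_opp//.
  have mNA : measurable (-%R @^-1` A : set R).
    by rewrite -[X in measurable X]setTI; exact: (@oppr_measurable R).
  exact: esym (lawX mNA).
have -> : \int[P]_w X' w = - \int[P]_w X w.
  by rewrite -mulN1r -RintegralZl//; apply: eq_Rintegral => w _; rewrite /X' mulN1r.
lra.
Qed.

End normal_variable.

Section independent_products.
Context dW (W : measurableType dW) (R : realType) (P : probability W R).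

(** The joint law is the product of the marginals, as it agrees with it on rectangles. By Fubini the
    inner integral is x E[Y] = 0. *)
Lemma independent_mul_mean (X Y : {RV P >-> R}) :
  P.-integrable setT (EFin \o X) ->
  P.-integrable setT (EFin \o (fun w => X w * Y w)) ->
  (forall A B, measurable A -> measurable B ->
    P (X @^-1` A `&` Y @^-1` B) = (P (X @^-1` A) * P (Y @^-1` B))%E) ->
  \int[P]_w Y w = 0 -> P.-integrable setT (EFin \o Y) ->
  \int[P]_w (X w * Y w) = 0.
Proof.
move=> iX iXY indXY EY iY.
have mXY : measurable_fun [set: W] (fun w => (X w, Y w)) by exact: measurable_fun_pair.
pose XY : {RV P >-> (R * R)%type} :=
  HB.pack (fun w => (X w, Y w)) (isMeasurableFun.Build _ _ _ _ _ mXY).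
pose f (q : R * R) := q.1 * q.2.
have mf : measurable_fun [set: R * R] (EFin \o f).
  by apply/measurable_EFinP; apply: measurable_funM.
have joint A : measurable A ->
    distribution P XY A = (distribution P X \x distribution P Y)%E A.
  move=> mA; apply/esym; apply: product_measure_unique mA => B C mB mC.
  exact: (indXY _ _ mB mC).
have Ef : (\int[P]_w (X w * Y w)%:E =
    \int[(distribution P X \x distribution P Y)%E]_q (f q)%:E)%E.
  transitivity (\int[distribution P XY]_q (f q)%:E)%E.
    by rewrite (integral_distribution (X := XY) (f := EFin \o f)).
  by apply: eq_measure_integral => A mA _; exact: joint.
have if' : (distribution P X \x distribution P Y)%E.-integrable setT (EFin \o f).
  apply/integrableP; split => //.
  rewrite [ltLHS](_ : _ = \int[P]_w `|(X w * Y w)%:E|)%E; last first.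
    transitivity (\int[distribution P XY]_q `|(f q)%:E|)%E.
      by apply: eq_measure_integral => A mA _; apply/esym; exact: joint.
    rewrite (ge0_integral_distribution XY (f := fun q => `|(f q)%:E|%E))//.
    exact: (measurableT_comp _ mf).
  by case/integrableP : iXY.
rewrite /Rintegral Ef -(integral12_prod_meas1 if') integral0_eq// => x _.
have iid : (distribution P Y).-integrable setT (EFin \o (id : R -> R)).
  apply/integrableP; split; first exact: EFin_measurable.
  rewrite (ge0_integral_distribution Y (f := fun y => `|y%:E|%E))//.
    by case/integrableP : iY.
  exact: (measurableT_comp _ (@EFin_measurable R setT)).
rewrite /fubini_F /=; transitivity ((x * \int[distribution P Y]_y y)%:E).
  rewrite -RintegralZl// /Rintegral fineK//.
  exact: integrable_fin_num (integrable_EFinZ x iid).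
have -> : \int[distribution P Y]_y y = \int[P]_w Y w.
  by rewrite /Rintegral (integral_distribution (X := Y) (f := EFin)).
by rewrite EY mulr0.
Qed.

Lemma mutually_independent_pair (J : finType) (xi : J -> {RV P >-> R}) k l :
  mutually_independent P (fun j => xi j) -> k != l ->
  forall A B, measurable A -> measurable B ->
  P (xi k @^-1` A `&` xi l @^-1` B) = (P (xi k @^-1` A) * P (xi l @^-1` B))%E.
Proof.
move=> indep kl A B mA mB.
pose D j := if j == k then A else if j == l then B else setT.
have mD j : measurable (D j) by rewrite /D; case: ifP => // _; case: ifP.
have := indep D mD; rewrite (bigD1 k)//= (bigD1 l)/=; last by rewrite eq_sym.
rewrite big1 ?mule1 => [|j /andP[jk jl]]; last first.
  by rewrite /D (negbTE jk) (negbTE jl) preimage_setT probability_setT.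
rewrite {2 3}/D eqxx eq_sym (negbTE kl) eqxx => <-; congr (P _).
apply/seteqP; split=> w /= => [[wk wl] j _|wD].
  by rewrite /D; case: eqP => [->//|_]; case: eqP => [->|].
split; first by have := wD k I; rewrite /D eqxx.
by have := wD l I; rewrite /D eq_sym (negbTE kl) eqxx.
Qed.

(** The cross terms of the expanded square vanish by independence and centering; each diagonal term
    costs 16 sigma^2. *)
Lemma normal_combination_sqr (J : finType) (xi : J -> {RV P >-> R}) (sigma : R)
    (c : J -> R) :
  0 < sigma -> mutually_independent P (fun j => xi j) ->
  (forall j, has_law P (xi j) (normal_prob 0 sigma)) ->
  P.-integrable setT (EFin \o (fun w => (\sum_j c j * xi j w) ^+ 2)) /\
  \int[P]_w ((\sum_j c j * xi j w) ^+ 2) <= 16 * sigma ^+ 2 * \sum_j c j ^+ 2.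
Proof.
move=> s0 indep law.
have isq j : P.-integrable setT (EFin \o (fun w => xi j w ^+ 2)).
  by have [] := normal_variable_sqr s0 (law j).
have iprod j k : P.-integrable setT (EFin \o (fun w => xi j w * xi k w)).
  have i2 : P.-integrable setT (EFin \o (fun w => xi j w ^+ 2 + xi k w ^+ 2)).
    by have := integrableD measurableT (isq j) (isq k).
  apply: le_integrable i2 => //.
    by apply/measurable_EFinP; exact: measurable_funM.
  move=> w _; rewrite /= lee_fin [leRHS]ger0_norm ?addr_ge0 ?sqr_ge0// normrM.
  have := normr_ge0 (xi j w); have := normr_ge0 (xi k w).
  have : `|xi j w| ^+ 2 = xi j w ^+ 2 by rewrite real_normK ?num_real.
  have : `|xi k w| ^+ 2 = xi k w ^+ 2 by rewrite real_normK ?num_real.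
  nra.
have E w : (\sum_j c j * xi j w) ^+ 2 =
    \sum_j \sum_k (c j * c k) * (xi j w * xi k w).
  rewrite expr2 big_distrlr /=.
  by apply: eq_bigr => j _; apply: eq_bigr => k _; ring.
have ijk j k : P.-integrable setT (EFin \o (fun w => (c j * c k) * (xi j w * xi k w))).
  exact: integrable_EFinZ.
have ij j : P.-integrable setT
    (EFin \o (fun w => \sum_k (c j * c k) * (xi j w * xi k w))).
  exact: integrable_EFin_sum.
split; first by under [X in _ \o X]eq_fun do rewrite E; exact: integrable_EFin_sum.
under eq_Rintegral do rewrite E.
rewrite Rintegral_sum// mulr_sumr; apply: ler_sum => j _.
rewrite Rintegral_sum// (bigD1 j)//= big1 ?addr0 => [|k kj].
  rewrite RintegralZl// -expr2 mulrC ler_wpM2r ?sqr_ge0//.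
  exact: (normal_variable_sqr s0 (law j)).2.
rewrite RintegralZl// (independent_mul_mean (X := xi j) (Y := xi k)) ?mulr0//.
- exact: normal_variable_integrable s0 (law j).
- by apply: mutually_independent_pair => //; rewrite eq_sym.
- exact: normal_variable_mean s0 (law k).
- exact: normal_variable_integrable s0 (law k).
Qed.

End independent_products.

(** * The Kalman filter *)

Section positive_matrices.
Context (R : realType).

Lemma psd_conj m n (A : 'M[R]_(m, n)) (P : 'M[R]_n) :
  possemidef P -> possemidef (A *m P *m A^T).
Proof.
move=> [sP P0]; split; first by rewrite !trmx_mul trmxK sP mulmxA.
move=> v; have := P0 (A^T *m v).
by rewrite trmx_mul trmxK !mulmxA.
Qed.

Lemma psdD n (P Q : 'M[R]_n) : possemidef P -> possemidef Q -> possemidef (P + Q).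
Proof.
move=> [sP P0] [sQ Q0]; split; first by rewrite linearD /= sP sQ.
by move=> v; rewrite mulmxDr mulmxDl mxE addr_ge0.
Qed.

Lemma psd_trace n (P : 'M[R]_n) : possemidef P -> 0 <= \tr P.
Proof.
move=> [_ P0]; have := @mxtrace_conj_ge0 R n n P 1%:M P0.
by rewrite trmx1 mul1mx mulmx1.
Qed.

Lemma coercive_unitmx n (A : 'M[R]_n) (c : R) : 0 < c ->
  (forall v : 'cV[R]_n, c * norm2 v ^+ 2 <= (v^T *m A *m v) 0 0) -> A \in unitmx.
Proof.
move=> c0 cA; rewrite -row_free_unit -kermx_eq0; apply/negPn/negP => /rowV0Pn[u].
move=> /sub_kermxP uA /negP; apply; rewrite -(inj_eq (can_inj (@trmxK _ _ _))) trmx0.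
rewrite -norm2_eq0 -sqrf_eq0 eq_le sqr_ge0 andbT.
have := cA u^T; rewrite trmxK uA mul0mx mxE.
by rewrite pmulr_rle0.
Qed.

(** For w = A^-1 e_i, coercivity gives c |w|^2 <= w . e_i <= |w|, so the diagonal entry w . e_i is
    at most |w| <= 1/c. *)
Lemma coercive_trace_inv n (A : 'M[R]_n) (c : R) : 0 < c ->
  (forall v : 'cV[R]_n, c * norm2 v ^+ 2 <= (v^T *m A *m v) 0 0) ->
  \tr (invmx A) <= n%:R / c.
Proof.
move=> c0 cA; have uA := coercive_unitmx c0 cA.
rewrite -[n in n%:R]card_ord -sumr_const mulr_suml ler_sum// => i _.
pose e : 'cV[R]_n := delta_mx i 0; pose w := invmx A *m e.
have wi : invmx A i i = (w^T *m e) 0 0.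
  by rewrite /e -colE /w -colE !mxE.
have e1 : norm2 e = 1.
  apply/eqP; rewrite -(@eqrXn2 _ 2)// ?norm2_ge0// expr1n norm2_sqr.
  by rewrite trmx_delta mul_delta_mx mxE !eqxx.
have := cA w; have -> : (w^T *m A *m w) 0 0 = (w^T *m e) 0 0.
  by rewrite -mulmxA /w mulKVmx.
have := dotmx_le w e; rewrite wi e1 mulr1 mul1r.
set x := (_ *m _) 0 0; set y := norm2 w => xy cy.
have y0 : 0 <= y by exact: norm2_ge0.
rewrite -[leRHS]mul1r ler_pdivlMr//.
have [yE|yN0] := eqVneq y 0; first by rewrite yE in xy; nra.
have yp : 0 < y by rewrite lt_def yN0 y0.
have cy1 : c * y <= 1 by rewrite -(ler_pM2r yp); nra.
nra.
Qed.

End positive_matrices.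

Section kalman_covariance.
Context (R : realType) (r No : nat).
Variables (sigma : R) (H : nat -> 'M[R]_(No, r)).
Hypothesis s0 : 0 < sigma.

(* Completing the square: the Joseph form at [G] exceeds that at the Kalman gain
   [K] by (G - K) S (G - K)^T, where S is the innovation covariance. *)
Lemma analysis_update_le P n (G : 'M[R]_(r, No)) : possemidef P ->
  \tr (analysis_update sigma H P n) <=
  \tr ((1%:M - G *m H n) *m P *m (1%:M - G *m H n)^T + sigma ^+ 2 *: (G *m G^T)).
Proof.
move=> pP; have [sP P0] := pP.
pose K := gain sigma H P n; pose S := H n *m P *m (H n)^T + (sigma ^+ 2)%:M.
have cS v : sigma ^+ 2 * norm2 v ^+ 2 <= (v^T *m S *m v) 0 0.
  have [_ HP0] := psd_conj (H n) pP.
  have -> : v^T *m S *m v =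
      v^T *m (H n *m P *m (H n)^T) *m v + sigma ^+ 2 *: (v^T *m v).
    by rewrite /S mulmxDr mulmxDl mul_mx_scalar -scalemxAl.
  by rewrite norm2_sqr [leRHS]mxE [X in _ <= _ + X]mxE lerDr.
have uS : S \in unitmx by apply: coercive_unitmx cS; rewrite exprn_gt0.
have sS : S^T = S by rewrite /S linearD /= !trmx_mul trmxK sP mulmxA tr_scalar_mx.
have KS : K *m S = P *m (H n)^T by rewrite /K /gain mulmxKV.
have SK : S *m K^T = H n *m P.
  by rewrite -[S in LHS]sS -trmx_mul KS trmx_mul trmxK sP.
(* The Joseph form as a quadratic polynomial in the gain, with P H^T and H P rewritten through the
   Kalman gain to make the square visible. *)
have J (A : 'M[R]_(r, No)) :
    (1%:M - A *m H n) *m P *m (1%:M - A *m H n)^T + sigma ^+ 2 *: (A *m A^T) =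
    P - A *m (S *m K^T) - (K *m S) *m A^T + A *m S *m A^T.
  have -> : A *m S *m A^T = A *m (H n *m P *m (H n)^T) *m A^T + sigma ^+ 2 *: (A *m A^T).
    by rewrite /S mulmxDr mulmxDl mul_mx_scalar -scalemxAl.
  rewrite SK KS.
  have -> : (1%:M - A *m H n)^T = 1%:M - (H n)^T *m A^T.
    by rewrite linearB /= trmx1 trmx_mul.
  rewrite mulmxBl mul1mx mulmxBr mulmx1 mulmxBl !mulmxA opprB.
  rewrite addrA [RHS]addrA; congr (_ + _); by rewrite addrAC.
rewrite /analysis_update -/K !J.
have -> : P - G *m (S *m K^T) - K *m S *m G^T + G *m S *m G^T =
   (P - K *m (S *m K^T) - K *m S *m K^T + K *m S *m K^T) +
   (G - K) *m S *m (G - K)^T.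
  have -> : (G - K)^T = G^T - K^T by rewrite linearB.
  rewrite mulmxBl mulmxBr !mulmxBl !mulmxA.
  by apply/matrixP => i j; rewrite !mxE; ring.
rewrite [leRHS]mxtraceD lerDl.
have pS : possemidef S.
  by split=> // v; rewrite (le_trans _ (cS v))// mulr_ge0 ?sqr_ge0.
exact: psd_trace (psd_conj (G - K) pS).
Qed.

Lemma analysis_trace_le P n (eta : R) : (0 < No)%N -> eta < 1 -> possemidef P ->
  opnorm2 (No%:R^-1 *: ((H n)^T *m H n) - 1%:M) <= eta ->
  \tr (analysis_update sigma H P n) <= r%:R * sigma ^+ 2 / (No%:R * (1 - eta)).
Proof.
move=> No0 eta1 pP gram; have nN0 : 0 < No%:R :> R by rewrite ltr0n.
set B := (H n)^T *m H n in gram; set c := No%:R * (1 - eta).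
have c0 : 0 < c by rewrite mulr_gt0// subr_gt0.
(* A Gram deviation of at most eta means that H^T H dominates No (1 - eta) times the identity. *)
have cB v : c * norm2 v ^+ 2 <= (v^T *m B *m v) 0 0.
  set D := _ - _ in gram.
  have BE : B = No%:R *: (1%:M + D).
    by rewrite /D addrC subrK scalerA mulfV ?scale1r// gt_eqF.
  have Dv : - (eta * norm2 v ^+ 2) <= (v^T *m D *m v) 0 0.
    rewrite lerNl -mulmxA; have := dotmx_le v (- (D *m v)).
    rewrite mulmxN [X in X <= _]mxE norm2N => /le_trans; apply.
    have := le_trans (norm2_mulmx_opnorm2 D v) (ler_wpM2r (norm2_ge0 v) gram).
    have := norm2_ge0 v; nra.
  have -> : v^T *m B *m v = No%:R *: (v^T *m v + v^T *m D *m v).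
    by rewrite BE -scalemxAr -scalemxAl mulmxDr mulmxDl mulmx1.
  rewrite [leRHS]mxE [X in _ <= _ * X]mxE -norm2_sqr /c -mulrA ler_pM2l//; lra.
have uB := coercive_unitmx c0 cB.
have sB : B^T = B by rewrite /B trmx_mul trmxK.
(* The least-squares gain satisfies G H = I, so the forecast covariance drops out of its Joseph form
   and the bound does not depend on the past of the filter. *)
apply: le_trans (analysis_update_le n (invmx B *m (H n)^T) pP) _.
have GH : invmx B *m (H n)^T *m H n = 1%:M by rewrite -mulmxA -/B mulVmx.
rewrite GH subrr !mul0mx add0r trmx_mul trmxK mulmxA GH mul1mx trmx_inv sB.
rewrite mxtraceZ [leRHS](_ : _ = sigma ^+ 2 * (r%:R / c)); last by ring.
rewrite ler_wpM2l ?sqr_ge0//.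
exact: coercive_trace_inv.
Qed.

End kalman_covariance.

Section analysis_error.
Context (R : realType) (r No : nat).
Variables (F Q : nat -> 'M[R]_r) (sigma : R) (P0 : 'M[R]_r) (H : nat -> 'M[R]_(No, r)).
Variables (m0 : 'cV[R]_r) (N : nat).
Hypotheses (pP0 : possemidef P0) (pQ : forall n, (n < N)%N -> possemidef (Q n)).

Lemma mean_update_error y mf n (zbar : 'cV[R]_r) (xi : nat -> 'cV[R]_No) :
  y n = H n *m zbar + xi n ->
  let K := gain sigma H (forecast_cov F Q sigma P0 H n) n in
  mean_update F Q sigma P0 H y mf n - zbar =
  (1%:M - K *m H n) *m (mf - zbar) + K *m xi n.
Proof.
move=> yE K; rewrite /mean_update -/K yE mulmxBl mul1mx !mulmxBr mulmxDr !mulmxA.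
by apply/matrixP => i j; rewrite !mxE; ring.
Qed.

(* The filter error is linear in the noises, and its covariance is dominated by
   the analysis covariance because the initial forecast is exact and the
   dynamics of the reference trajectory is noiseless. *)
Lemma analysis_error_gain n : (n <= N)%N ->
  exists G : nat -> 'M[R]_(r, No),
    (forall xi : nat -> 'cV[R]_No,
      analysis_mean F Q sigma P0 H m0 (fun k => H k *m reference F m0 k + xi k) n -
      reference F m0 n = \sum_(k < n.+1) G k *m xi k) /\
    possemidef (analysis_cov F Q sigma P0 H n -
      sigma ^+ 2 *: \sum_(k < n.+1) G k *m (G k)^T).
Proof.
elim: n => [|n IHn] nN.
  exists (fun=> gain sigma H P0 0); split.
    move=> xi; rewrite big_ord1 /analysis_mean.
    by rewrite (@mean_update_error _ _ _ (reference F m0 0) xi)//= subrr mulmx0 add0r.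
  by rewrite big_ord1 /analysis_cov /analysis_update addrK; exact: psd_conj.
have [G [errG covG]] := IHn (ltnW nN).
pose K := gain sigma H (forecast_cov F Q sigma P0 H n.+1) n.+1.
pose A := 1%:M - K *m H n.+1.
(* Earlier noises are carried through the forecast and the update; the new noise enters through the
   current gain. *)
pose G' k := if k == n.+1 then K else A *m F n *m G k.
have G'E (k : 'I_n.+1) : G' k = A *m F n *m G k.
  by rewrite /G' ltn_eqF.
have G'n : G' n.+1 = K by rewrite /G' eqxx.
exists G'; split.
  move=> xi; rewrite big_ord_recr G'n /analysis_mean.
  rewrite (@mean_update_error _ _ _ (reference F m0 n.+1) xi)//; congr (_ + _).
  have -> : reference F m0 n.+1 = F n *m reference F m0 n by [].
  rewrite [forecast_mean _ _ _ _ _ _ _ _]/= -mulmxBr.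
  transitivity (A *m (F n *m \sum_(k < n.+1) G k *m xi k)).
    by rewrite -(errG xi).
  rewrite mulmxA mulmx_sumr.
  by apply: eq_bigr => k _; rewrite G'E mulmxA.
rewrite big_ord_recr /= G'n.
have -> : \sum_(k < n.+1) G' k *m (G' k)^T =
    A *m (F n *m (\sum_(k < n.+1) G k *m (G k)^T) *m (F n)^T) *m A^T.
  rewrite mulmx_sumr mulmx_suml mulmx_sumr mulmx_suml.
  by apply: eq_bigr => k _; rewrite G'E !trmx_mul !mulmxA.
have -> : analysis_cov F Q sigma P0 H n.+1 =
    A *m (F n *m analysis_cov F Q sigma P0 H n *m (F n)^T + Q n) *m A^T +
    sigma ^+ 2 *: (K *m K^T) by [].
(* The terms sigma^2 K K^T cancel. What remains is the previous difference and Q_n, both transported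
   by congruences. *)
rewrite scalerDr opprD addrACA subrr addr0.
rewrite scalemxAl scalemxAr -mulmxBl -mulmxBr.
apply: psd_conj; rewrite addrAC scalemxAl scalemxAr -mulmxBl -mulmxBr.
by apply: psdD; [exact: psd_conj|exact: pQ].
Qed.

End analysis_error.

Section reference_error.
Context (R : realType) (r : nat) (F : nat -> 'M[R]_r) (z : nat -> 'cV[R]_r).

Lemma propagatorS n k : (k <= n)%N -> propagator F n.+1 k = F n *m propagator F n k.
Proof.
move=> kn; rewrite /propagator /index_iota subSn// -addn1 iotaD rev_cat /= subnKC//.
by rewrite big_cons.
Qed.

Lemma propagator_id n : propagator F n n = 1%:M.
Proof. by rewrite /propagator /index_iota subnn big_nil. Qed.

(** Discrete Duhamel formula: each one-step defect is propagated to time n. *)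
Lemma reference_deviation n :
  z n - reference F (z 0%N) n =
  \sum_(k < n) propagator F n k.+1 *m (z k.+1 - F k *m z k).
Proof.
elim: n => [|n IHn]; first by rewrite big_ord0 subrr.
rewrite big_ord_recr /= propagator_id mul1mx.
under eq_bigr => k _ do rewrite propagatorS// -mulmxA.
rewrite -mulmx_sumr -IHn mulmxBr addrC addrA subrK.
by [].
Qed.

Lemma reference_deviation_le N (dt eps Cb p ST : R) n :
  0 <= dt -> 0 <= eps -> 0 <= Cb -> 1 <= ST ->
  dynamics_input F z N dt eps Cb p ST -> (n <= N)%N ->
  norm2 (z n - reference F (z 0%N) n) <=
  N%:R * dt * ST * Cb * (eps + dt `^ p).
Proof.
move=> dt0 eps0 Cb0 ST1 [propST bE] nN; rewrite reference_deviation.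
have ST0 : 0 <= ST by rewrite (le_trans ler01).
have c0 : 0 <= Cb * dt * (eps + dt `^ p).
  by rewrite !mulr_ge0// addr_ge0// powR_ge0.
have norm_sum m (v : 'I_m -> 'cV[R]_r) : norm2 (\sum_k v k) <= \sum_k norm2 (v k).
  elim: m v => [|m IHm] v; first by rewrite !big_ord0 norm2_0.
  by rewrite !big_ord_recl (le_trans (norm2D _ _))// lerD2l.
apply: le_trans (norm_sum _ _) _.
(* At most N defects, each of size dt and amplified by at most ST, accumulate to order N dt, the
   time horizon. *)
apply: (@le_trans _ _ (\sum_(k < n) ST * (Cb * dt * (eps + dt `^ p)))).
  apply: ler_sum => k _; apply: le_trans (norm2_mulmx_opnorm2 _ _) _.
  apply: (@le_trans _ _ (ST * norm2 (z k.+1 - F k *m z k))).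
    by rewrite ler_wpM2r ?norm2_ge0// propST// ltn_ord nN.
  by rewrite ler_wpM2l// bE// (leq_trans (ltn_ord k)).
rewrite sumr_const card_ord -[leLHS]mulr_natl.
rewrite [leRHS](_ : _ = N%:R * (ST * (Cb * dt * (eps + dt `^ p)))); last by ring.
by apply: ler_wpM2r; [exact: mulr_ge0|rewrite ler_nat].
Qed.

End reference_error.

Section noise_energy.
Context dW (W : measurableType dW) (R : realType) (P : probability W R).
Variables (N No r : nat) (xi : nat -> 'I_No -> {RV P >-> R}) (sigma : R).
Hypothesis s0 : 0 < sigma.
Hypothesis indep : mutually_independent P (fun k : 'I_N.+1 * 'I_No => xi k.1 k.2).
Hypothesis law : forall n i, (n <= N)%N -> has_law P (xi n i) (normal_prob 0 sigma).
Variables (n : nat) (G : nat -> 'M[R]_(r, No)).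
Hypothesis nN : (n <= N)%N.

Let e w : 'cV[R]_r := \sum_(k < n.+1) G k *m \col_i xi k i w.

(** Row a of the error as one linear form in the whole noise family, indexed by time and sensor up
    to N; noises after time n get coefficient 0. *)
Let c a (p : 'I_N.+1 * 'I_No) := if (p.1 < n.+1)%N then G p.1 a p.2 else 0.

Let sum_pairs (f : 'I_N.+1 * 'I_No -> R) (g : nat -> 'I_No -> R) :
  (forall p, f p = if (p.1 < n.+1)%N then g p.1 p.2 else 0) ->
  \sum_p f p = \sum_(k < n.+1) \sum_j g k j.
Proof.
move=> fE; rewrite (big_ord_widen N.+1 (fun k => \sum_j g k j)) ?ltnS// [RHS]big_mkcond.
rewrite (eq_bigr (fun p => f (p.1, p.2))) => [|[]//].
rewrite -(pair_bigA _ (fun (k : 'I_N.+1) (j : 'I_No) => f (k, j))) /=.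
apply: eq_bigr => k _; under eq_bigr do rewrite fE /=.
by case: ifP => // _; rewrite big1.
Qed.

Let eE w a : e w a 0 = \sum_p c a p * xi p.1 p.2 w.
Proof.
rewrite (@sum_pairs _ (fun k j => G k a j * xi k j w)) => [|p]; last first.
  by rewrite /c; case: ifP => // _; rewrite mul0r.
rewrite /e summxE; apply: eq_bigr => k _; rewrite mxE.
by apply: eq_bigr => j _; rewrite mxE.
Qed.

Lemma noise_energy :
  P.-integrable setT (EFin \o (fun w => norm2 (e w) ^+ 2)) /\
  \int[P]_w (norm2 (e w) ^+ 2) <=
  16 * \tr (sigma ^+ 2 *: \sum_(k < n.+1) G k *m (G k)^T).
Proof.
have E w : norm2 (e w) ^+ 2 = \sum_a (\sum_p c a p * xi p.1 p.2 w) ^+ 2.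
  rewrite norm2_sqr mxE; apply: eq_bigr => a _.
  by rewrite -eE mxE expr2.
have comb a := normal_combination_sqr (c a) s0 indep
  (fun p => law p.2 (ltn_ord p.1 : (p.1 <= N)%N)).
split.
  under [X in _ \o X]eq_fun do rewrite E.
  by apply: integrable_EFin_sum => a; exact: (comb a).1.
under eq_Rintegral do rewrite E.
rewrite Rintegral_sum => [|a]; last exact: (comb a).1.
apply: le_trans (ler_sum _ (fun a _ => (comb a).2)) _.
rewrite -mulr_sumr mxtraceZ -mulrA ler_wpM2l// ler_wpM2l ?sqr_ge0//.
rewrite raddf_sum /= le_eqVlt; apply/orP; left; apply/eqP.
under eq_bigr => a _.
  rewrite (@sum_pairs _ (fun k j => G k a j ^+ 2)); last first.
    by move=> p; rewrite /c; case: ifP => // _; rewrite expr0n.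
  over.
rewrite exchange_big; apply: eq_bigr => k _; apply: eq_bigr => a _ /=.
by rewrite mxE; apply: eq_bigr => j _; rewrite mxE expr2.
Qed.

End noise_energy.

(** * From coefficient errors to L^2 errors *)

Section synthesis_error.
Context d (T : measurableType d) (R : realType) (mu : {measure set T -> \bar R}).
Variables (m : nat) (tau : R) (fs : feature_space mu m tau).
Hypothesis tau0 : 0 <= tau.

Lemma measurable_synthesis (v : 'cV[R]_(eff_rank fs)) :
  measurable_fun [set: T] (synthesis v).
Proof.
rewrite (_ : synthesis v = fun t => \sum_a Psi fs t a 0 * v a 0).
  by apply: measurable_sum => a; apply: measurable_funM => //; exact: measurable_Psi.
by apply/funext => t; rewrite /synthesis mxE; apply: eq_bigr => a _; rewrite [_^T _ _]mxE.
Qed.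

Lemma sqr_synthesis_error (u : T -> R) (eps : R) (v z : 'cV[R]_(eff_rank fs)) :
  measurable_fun [set: T] u -> 0 <= eps ->
  (L2norm mu (u \- synthesis z)%R <= eps%:E)%E ->
  (L2norm mu (synthesis v \- u)%R ^+ 2 <=
   (2 * norm2 (v - z) ^+ 2 + 2 * eps ^+ 2)%:E)%E.
Proof.
move=> mu_ eps0 uz.
have synB t : synthesis (v - z) t = synthesis v t - synthesis z t.
  by rewrite /synthesis mulmxBr !mxE.
have [iS ES] := Rintegral_sqr_synthesis tau0 (v - z).
have ms := measurable_synthesis (v - z).
have muz : measurable_fun [set: T] (fun t => u t - synthesis z t).
  by apply: measurable_funB => //; exact: measurable_synthesis.
rewrite sqr_L2norm.
(* Pointwise (a - c)^2 <= 2 (a - b)^2 + 2 (b - c)^2 with b the synthesis of the reference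
   coefficients. The first term is computed by the isometry, the second is the approximation
   error. *)
apply: (@le_trans _ _ (\int[mu]_t (2%:E * (synthesis (v - z) t ^+ 2)%:E +
    2%:E * ((u t - synthesis z t) ^+ 2)%:E))%E).
  apply: ge0_le_integral => //.
  - by move=> t _; rewrite lee_fin sqr_ge0.
  - apply/measurable_EFinP; apply: measurable_funX; apply: measurable_funB => //.
    exact: measurable_synthesis.
  - apply: emeasurable_funD; apply: measurable_funeM; apply/measurable_EFinP;
      exact: measurable_funX.
  - move=> t _; rewrite -!EFinM -EFinD lee_fin synB /=.
    set a := synthesis v t; set b := synthesis z t; set c := u t.
    have := sqr_ge0 ((a - b) - (b - c)); have := sqr_ge0 (a - 2 * b + c); nra.
rewrite ge0_integralD//; first last.
- by apply: measurable_funeM; apply/measurable_EFinP; exact: measurable_funX.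
- by move=> t _; rewrite mule_ge0// lee_fin sqr_ge0.
- by apply: measurable_funeM; apply/measurable_EFinP; exact: measurable_funX.
- by move=> t _; rewrite mule_ge0// lee_fin sqr_ge0.
rewrite !ge0_integralZl//; first last.
- by move=> t _; rewrite lee_fin sqr_ge0.
- by apply/measurable_EFinP; exact: measurable_funX.
- by move=> t _; rewrite lee_fin sqr_ge0.
- by apply/measurable_EFinP; exact: measurable_funX.
have -> : (2 * norm2 (v - z) ^+ 2 + 2 * eps ^+ 2)%:E =
    (2%:E * (norm2 (v - z) ^+ 2)%:E + 2%:E * (eps%:E * eps%:E))%E.
  by rewrite -!EFinM -EFinD -expr2.
apply: leeD; apply: lee_wpmul2l => //.
  by rewrite -ES /Rintegral fineK//; exact: integrable_fin_num.
rewrite -[leLHS](sqr_L2norm mu (u \- synthesis z)).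
by apply: lee_pmul; rewrite ?Lnorm_ge0.
Qed.

End synthesis_error.

Section nonmeasurable_integral.
Import HBNNSimple.

(** The integral of a nonnegative function is a supremum over the simple functions below it, hence
    monotone for arbitrary functions. It spares a proof that the squared L^2 error is measurable in
    the noise. *)
Lemma ge0_le_integral_nonmeasurable d (T : measurableType d) (R : realType)
    (mu : {measure set T -> \bar R}) (f g : T -> \bar R) :
  (forall t, 0 <= f t)%E -> (forall t, f t <= g t)%E ->
  (\int[mu]_t f t <= \int[mu]_t g t)%E.
Proof.
move=> f0 fg; have g0 t : (0 <= g t)%E by exact: le_trans (f0 t) (fg t).
rewrite !ge0_integralTE//; apply: le_ereal_sup => _ [h hf <-].
by exists h => // t; exact: le_trans (hf t) (fg t).
Qed.

End nonmeasurable_integral.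

Section filter_error.
Context d (T : measurableType d) (R : realType) (mu : {measure set T -> \bar R}).
Variables (m : nat) (tau : R) (fs : feature_space mu m tau).
Context dW (W : measurableType dW) (P : probability W R).
Variables (N No : nat) (xi : nat -> 'I_No -> {RV P >-> R}) (sigma : R).
Hypotheses (tau0 : 0 <= tau) (s0 : 0 < sigma).
Hypothesis indep : mutually_independent P (fun k : 'I_N.+1 * 'I_No => xi k.1 k.2).
Hypothesis law : forall n i, (n <= N)%N -> has_law P (xi n i) (normal_prob 0 sigma).
Local Notation r := (eff_rank fs).
Variables (F Q : nat -> 'M[R]_r) (P0 : 'M[R]_r) (H : nat -> 'M[R]_(No, r)).
Variables (z : nat -> 'cV[R]_r) (dt eps Cb p ST : R) (u : T -> R) (n : nat).
Hypotheses (pP0 : possemidef P0) (pQ : forall k, (k < N)%N -> possemidef (Q k)).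
Hypotheses (dt0 : 0 <= dt) (eps0 : 0 <= eps) (Cb0 : 0 <= Cb) (ST1 : 1 <= ST).
Hypothesis dyn : dynamics_input F z N dt eps Cb p ST.
Hypotheses (nN : (n <= N)%N) (mu_ : measurable_fun [set: T] u).
Hypothesis uz : (L2norm mu (u \- synthesis (z n))%R <= eps%:E)%E.

Local Notation zbar := (reference F (z 0%N)).
Local Notation mean w := (analysis_mean F Q sigma P0 H (z 0%N)
  (fun k => H k *m zbar k + \col_i xi k i w) n).

Lemma filter_mean_square_error :
  (\int[P]_w (L2norm mu (synthesis (mean w) \- u)%R ^+ 2) <=
   (64 * \tr (analysis_cov F Q sigma P0 H n) +
    4 * (N%:R * dt * ST * Cb * (eps + dt `^ p)) ^+ 2 + 2 * eps ^+ 2)%:E)%E.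
Proof.
have [G [errG [_ covG]]] := analysis_error_gain F sigma H (z 0%N) pP0 pQ nN.
pose e w : 'cV[R]_r := \sum_(k < n.+1) G k *m \col_i xi k i w.
set D := N%:R * dt * ST * Cb * _.
have zD : norm2 (zbar n - z n) <= D.
  rewrite -norm2N opprB.
  exact: (reference_deviation_le dt0 eps0 Cb0 ST1 dyn nN).
have trG : \tr (sigma ^+ 2 *: \sum_(k < n.+1) G k *m (G k)^T) <=
    \tr (analysis_cov F Q sigma P0 H n).
  rewrite -subr_ge0 -mxtraceB.
  have := @mxtrace_conj_ge0 R _ _ _ 1%:M covG.
  by rewrite trmx1 mul1mx mulmx1.
have [ie Ee] := noise_energy s0 indep law G nN.
(* The coefficient error is the noise part plus a bias of size at most D, so its doubled square is
   at most 4 |e|^2 + 4 D^2. The noise energy bound 16 tr then gives the 64 of the conclusion. *)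
pose g w : R := 4 * norm2 (e w) ^+ 2 + (4 * D ^+ 2 + 2 * eps ^+ 2).
apply: (@le_trans _ _ (\int[P]_w (g w)%:E)%E).
  apply: ge0_le_integral_nonmeasurable => [w|w].
    by rewrite sqr_L2norm integral_ge0// => t _; rewrite lee_fin sqr_ge0.
  apply: le_trans (sqr_synthesis_error tau0 (mean w) mu_ eps0 uz) _.
  rewrite lee_fin /g addrA lerD2r.
  have -> : mean w - z n = e w + (zbar n - z n).
    by rewrite /e -(errG (fun k => \col_i xi k i w)) addrA subrK.
  have h := norm2D (e w) (zbar n - z n).
  have := norm2_ge0 (e w + (zbar n - z n)); have := norm2_ge0 (zbar n - z n).
  have := norm2_ge0 (e w).
  set a := norm2 (e w) in h *; set b := norm2 (zbar n - z n) in h zD *.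
  set c := norm2 (_ + _) in h * => a0 b0 c0.
  have cab : c ^+ 2 <= (a + b) ^+ 2 by rewrite ler_pXn2r// nnegrE addr_ge0.
  have bD : b ^+ 2 <= D ^+ 2 by rewrite ler_pXn2r// nnegrE (le_trans b0).
  have := sqr_ge0 (a - b); nra.
have ic (x : R) : P.-integrable setT (EFin \o (fun _ : W => x)).
  exact: (bmfun_integrable P (bmfun_cst _ x)).
have ig : P.-integrable setT (EFin \o g).
  exact: (integrableD measurableT (integrable_EFinZ 4 ie) (ic (4 * D ^+ 2 + 2 * eps ^+ 2))).
rewrite -(fineK (integrable_fin_num measurableT ig)) lee_fin.
rewrite -[leLHS]/(\int[P]_w g w) RintegralD//; last exact: integrable_EFinZ.
rewrite bmE_cst RintegralZl// addrA !lerD2r.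
lra.
Qed.

End filter_error.

(** * The theorem *)

(** Tonelli: the product measure integrates the measures of the sections, which are at least c over
    A. *)
Lemma product_probability_ge d1 d2 (T1 : measurableType d1) (T2 : measurableType d2)
    (R : realType) (P1 : probability T1 R) (P2 : probability T2 R)
    (A : set T1) (B : set (T1 * T2)) (c : R) :
  0 <= c -> measurable A -> measurable B ->
  (forall x, A x -> (c%:E <= P2 (xsection B x))%E) ->
  (c%:E * P1 A <= (P1 \x P2) B)%E.
Proof.
move=> c0 mA mB AB.
have -> : P1 A = (\int[P1]_x (\1_A x)%:E)%E by rewrite integral_indic// setIT.
rewrite -ge0_integralZl//; last first.
  by apply/measurable_EFinP; exact: measurable_indic.
apply: ge0_le_integral => //.
- by move=> x _; rewrite mule_ge0// lee_fin.
- by apply: measurable_funeM; apply/measurable_EFinP; exact: measurable_indic.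
- exact: measurable_fun_xsection.
- move=> x _ /=; rewrite indicE; case: (boolP (x \in A)) => [/set_mem/AB|_].
    by rewrite mule1.
  by rewrite mule0.
Qed.

Theorem theorem3p1 (R : realType) :
  exists (C : R) (CT : R -> R -> R -> R), 0 < C /\
  forall (d : nat) (Omega : C11_domain R d)
    (nu T dt : R) (N : nat) (u0 : 'rV[R]_d.+1 -> R)
    (ustar : R -> 'rV[R]_d.+1 -> R) (m : nat) (tau eps Lstar : R)
    (eta dgram : R) (No : nat)
    (dS : measure_display) (S : measurableType dS) (PS : probability S R)
    (X : nat -> 'I_No -> {RV PS >-> 'rV[R]_d.+1}),
  let mu := normalized_volume Omega in
  let r (fs : feature_space mu m tau) := eff_rank fs in
  let sensors (s : S) := fun n i => X n i s in
  0 < nu -> 0 < dt -> T = N%:R * dt ->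
  heat_solution Omega nu T u0 ustar ->
  0 <= tau ->
  mutually_independent PS (fun k : 'I_N.+1 * 'I_No => X k.1 k.2) ->
  (forall n i, (n <= N)%N -> has_law PS (X n i) mu) ->
  0 < eta < 1 -> 0 < dgram < 1 ->
  (* a frozen feature draw *)
  (forall (fs : feature_space mu m tau) (z : nat -> 'cV[R]_(r fs)),
    approximates ustar dt N eps z ->
    (leverage fs <= Lstar%:E)%E -> (r fs)%:R <= Lstar ->
    sample_size fs C Lstar eta dgram N <= No%:R ->
    ((1 - dgram)%:E <=
       PS [set s | gram_event fs N eta (sensors s)])%E /\
    (* The noises live on their own probability space W, so the conditional
       expectation given the sensor matrices is the integral over W with the
       sensor outcome s frozen. *)
    forall (Cb p ST : R) (F Q : nat -> 'M[R]_(r fs)) (P0 : 'M[R]_(r fs))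
      (sigma : R)
      (dW : measure_display) (W : measurableType dW) (PW : probability W R)
      (xi : nat -> 'I_No -> {RV PW >-> R}),
    0 < Cb -> 0 < p -> 1 <= ST ->
    dynamics_input F z N dt eps Cb p ST ->
    0 < sigma ->
    mutually_independent PW (fun k : 'I_N.+1 * 'I_No => xi k.1 k.2) ->
    (forall n i, (n <= N)%N -> has_law PW (xi n i) (normal_prob 0 sigma)) ->
    (forall n, (n < N)%N -> possemidef (Q n)) ->
    let H s n := sensor_matrix fs (sensors s n) in
    let zbar := reference F (z 0%N) in
    let y s w n := H s n *m zbar n + \col_i xi n i w in
    let uhat s n w := synthesis
      (analysis_mean F Q sigma P0 (H s) (zbar 0%N) (y s w) n) in
    (forall s n, (n <= N)%N -> posdef (forecast_cov F Q sigma P0 (H s) n)) ->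
    forall s, gram_event fs N eta (sensors s) ->
      (forall n, (n <= N)%N ->
        \tr (analysis_cov F Q sigma P0 (H s) n) <=
        (r fs)%:R * sigma ^+ 2 / (No%:R * (1 - eta))) /\
      (forall n, (n <= N)%N ->
        (\int[PW]_w (L2norm mu (uhat s n w \- ustar (n%:R * dt))%R ^+ 2) <=
         (CT T ST Cb * (eps ^+ 2 + dt `^ (2 * p) +
           (r fs)%:R * sigma ^+ 2 / (No%:R * (1 - eta))))%R%:E)%E)) /\
  (* a random feature draw, independent of the sensor locations *)
  (forall (dTh : measure_display) (Th : measurableType dTh)
     (PTh : probability Th R) (fs : Th -> feature_space mu m tau)
     (dapp dlev : R),
    let app := [set th | exists z, approximates (fs := fs th) ustar dt N eps z] in
    let lev := [set th | (leverage (fs th) <= Lstar%:E)%E] in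
    let gram := [set q : Th * S | gram_event (fs q.1) N eta (sensors q.2)] in
    measurable app -> measurable lev -> measurable gram ->
    PTh (~` app) = dapp%:E -> PTh (~` lev) = dlev%:E ->
    (forall th, app th -> lev th ->
      (r (fs th))%:R <= Lstar /\
      sample_size (fs th) C Lstar eta dgram N <= No%:R) ->
    ((1 - dapp - dlev - dgram)%:E <=
       (PTh \x PS) [set q | [/\ app q.1, lev q.1 & gram q]])%E).

Proof.
(* The 64 is the noise factor of [filter_mean_square_error]; it also covers the 2 in front of eps^2.
   The bias 4 (q (eps + dt^p))^2 with q = T ST Cb is at most 8 q^2 (eps^2 + dt^(2p)). The rank does
   not occur. *)
exists 120, (fun T ST Cb => 64 + 8 * (T * ST * Cb) ^+ 2); split=> //.
move=> d Omega nu T dt N u0 ustar m tau eps Lstar eta dgram No dS S PS X mu r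
  sensors nu0 dt0 TE heat tau0 indep lawX eta01 dgram01.
have [[_ uL2] _ _ _ _] := heat.
have gramP (fs : feature_space mu m tau) : (leverage fs <= Lstar%:E)%E ->
    (r fs)%:R <= Lstar -> sample_size fs 120 Lstar eta dgram N <= No%:R ->
    ((1 - dgram)%:E <= PS [set s | gram_event fs N eta (sensors s)])%E.
  move=> lev rL sz.
  exact: (gram_event_probability indep lawX tau0 eta01 dgram01 lev rL sz).
split.
- move=> fs z app lev rL sz; split; first exact: gramP.
  move=> Cb p ST F Q P0 sigma dW W PW xi Cb0 p0 ST1 dyn s0 indxi lawxi pQ H zbar
    y uhat pdP s gram.
  have No0 : (0 < No)%N := sample_size_gt0 eta01 dgram01 rL sz.
  have [eta0 eta1] := andP eta01.
  have psdP n : (n <= N)%N -> possemidef (forecast_cov F Q sigma P0 (H s) n).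
    move=> nN; have [sP P_gt0] := pdP s n nN; split=> // v.
    have [->|/P_gt0/ltW//] := eqVneq v 0; by rewrite mulmx0 mxE.
  have trP n : (n <= N)%N -> \tr (analysis_cov F Q sigma P0 (H s) n) <=
      (r fs)%:R * sigma ^+ 2 / (No%:R * (1 - eta)).
    by move=> nN; apply: analysis_trace_le => //; [exact: psdP|exact: gram].
  split=> // n nN.
  (* The sign of eps is inherited from the L^2 norm that it bounds. *)
  have eps0 : 0 <= eps.
    by have := app n nN; rewrite -lee_fin; apply: le_trans; exact: Lnorm_ge0.
  have mu_ : measurable_fun [set: 'rV[R]_d.+1] (ustar (n%:R * dt)).
    have [] := uL2 (n%:R * dt); rewrite // mulr_ge0 ?(ltW dt0)//.
    by rewrite TE ler_wpM2r ?(ltW dt0)// ler_nat.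
  apply: le_trans (filter_mean_square_error tau0 s0 indxi lawxi (H s) (psdP 0%N isT)
    pQ (ltW dt0) eps0 (ltW Cb0) ST1 dyn nN mu_ (app n nN)) _.
  rewrite lee_fin -TE.
  have -> : dt `^ (2 * p) = (dt `^ p) ^+ 2.
    by rewrite mulrC powRrM powR_mulrn// powR_ge0.
  have := trP n nN; set t := \tr _; set x := _ / _ => tx.
  set q := T * ST * Cb; set b := dt `^ p.
  have b0 : 0 <= b by exact: powR_ge0.
  have x0 : 0 <= x.
    by apply: divr_ge0; apply: mulr_ge0; rewrite ?ler0n ?sqr_ge0 ?subr_ge0 ?(ltW eta1).
  have q2 : 0 <= q ^+ 2 by exact: sqr_ge0.
  have h1 : (q * (eps + b)) ^+ 2 <= 2 * q ^+ 2 * (eps ^+ 2 + b ^+ 2).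
    rewrite exprMn [leRHS](_ : _ = q ^+ 2 * (2 * (eps ^+ 2 + b ^+ 2))); last by ring.
    by rewrite ler_wpM2l//; have := sqr_ge0 (eps - b); nra.
  have h2 : 0 <= q ^+ 2 * x by rewrite mulr_ge0.
  have := sqr_ge0 eps; have := sqr_ge0 b; nra.
- move=> dTh Th PTh fs dapp dlev app lev gram mapp mlev mgram appE levE sizes.
  have [d0 d1] := andP dgram01.
  set B := [set q | _].
  have mAL : measurable (app `&` lev) by exact: measurableI.
  have BE : B = (fst @^-1` (app `&` lev)) `&` gram.
    by apply/seteqP; split=> q /= => [[]|[[]]].
  have mB : measurable B.
    rewrite BE; apply: measurableI => //.
    by rewrite -[X in measurable X]setTI; exact: measurable_fst.
  have BAL : ((1 - dgram)%:E * PTh (app `&` lev) <= (PTh \x PS) B)%E.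
    apply: product_probability_ge => //; first by lra.
    move=> th [[z appth] levth].
    have [rL sz] := sizes th (ex_intro _ z appth) levth.
    rewrite (_ : xsection B th = [set s | gram_event (fs th) N eta (sensors s)]).
      exact: gramP.
    apply/seteqP; split=> s; rewrite /xsection /= inE BE /=; first by case.
    by move=> ?; split=> //; split=> //; exists z.
  apply: le_trans BAL.
  have : (PTh (~` (app `&` lev)) <= (dapp + dlev)%:E)%E.
    rewrite setCI EFinD -appE -levE.
    by apply: measureU2; exact: measurableC.
  have : (PTh (app `&` lev) <= 1)%E by exact: probability_le1.
  rewrite probability_setC// -(fineK (fin_num_measure PTh _ mAL)).
  rewrite -EFinB -EFinM !lee_fin.
  (* Since t <= 1, (1 - dgram) t >= t - dgram, so the failure probabilities add up. *)
  set t := fine (PTh _); nra.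
Qed.
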